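(* With the coproduct $\Delta$, the vertical product $\nabla$, the map $S$, the counit $\varepsilon$ and the unit $\eta$ described in the context, the bicollection $(T(\mathcal{NC}),\Delta,\nabla,S,\varepsilon,\eta)$ of words on non-crossing partitions (with concatenation as horizontal product) is a co-nilpotent $\boxtimes\otimes_h$-Hopf algebra.
   Context: All vector spaces are over $\mathbb C$. A collection is a family $(P(n))_{n\ge1}$ of vector spaces; a bicollection is a family $P=(P(n,m))_{n,m\ge 0}$ of vector spaces ($n$ outputs, $m$ inputs); morphisms are families of linear maps. Horizontal tensor product: $(P\otimes_h Q)(n,m)=\bigoplus_{n_1+n_2=n,\ m_1+m_2=m}P(n_1,m_1)\otimes Q(n_2,m_2)$, with unit $\mathbf 1_h$ ($\mathbf 1_h(0,0)=\mathbb C1_0$, zero otherwise). Vertical tensor product: $(P\boxtimes Q)(n,m)=\bigoplus_{k\ge 0}P(n,k)\otimes Q(k,m)$, with unit $\mathbf 1_v$ ($\mathbf 1_v(n,n)=\mathbb C1_n$, zero for $n\neq m$). Exchange map: $R:(C_1\boxtimes C_2)\otimes_h(C_3\boxtimes C_4)\to(C_1\otimes_h C_3)\boxtimes(C_2\otimes_h C_4)$, $(p^1\boxtimes p^2)\otimes_h(p^3\boxtimes p^4)\mapsto(p^1\otimes_h p^3)\boxtimes(p^2\otimes_h p^4)$. A horizontal algebra is a monoid in $(\mathrm{Coll}_2,\otimes_h,\mathbf 1_h)$; $\mathrm{Alg}_h$ is the category of these. If $A,A'$ are horizontal algebras so is $A\boxtimes A'$, with product $(m^A\boxtimes m^{A'})\circ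 R$; $\mathbf 1_v$ is a horizontal algebra via $1_n\otimes_h1_m\mapsto 1_{n+m}$. A PROS is a monoid, and a $\boxtimes\otimes_h$-bialgebra a comonoid, in the monoidal category $(\mathrm{Alg}_h,\boxtimes,\mathbf 1_v)$ (so vertical product/unit, resp. coproduct/counit, are horizontal algebra morphisms). A $\boxtimes\otimes_h$-Hopf algebra is a bicollection which is, for the same horizontal algebra structure, both a bialgebra (with $\Delta,\varepsilon$) and a PROS (with $\nabla,\eta$), with a horizontal algebra morphism $S$ such that $\nabla\circ(S\boxtimes\mathrm{id})\circ\Delta=\nabla\circ(\mathrm{id}\boxtimes S)\circ\Delta=\eta\circ\varepsilon$. No compatibility between $\Delta$ and $\nabla$ is required. A $\boxtimes\otimes_h$-bialgebra $(C,\Delta,\varepsilon)$ is co-nilpotent if: (1) $C(n,n)=\mathbb C1_n$ for $n\ge0$ and $C(0,m)=C(m,0)=0$ for $m\ge1$; (2) $\Delta(1_n)=1_n\boxtimes1_n$, and for $c\in C(n,m)$ with $n\ne m$, $\Delta(c)=\Delta^{\mathrm{red}}(c)+1_n\boxtimes c+c\boxtimes1_m$ with $\Delta^{\mathrm{red}}(c)\in\bigoplus_{k\ne n,m}C(n,k)\otimes C(k,m)$; (3) for each $c\in C(n,m)$, $n\neq m$, some iterate of $\Delta^{\mathrm{red}}$ vanishes on $c$. For a collection $P$, $T(P)$ is the bicollection of words: $T(P)(0,0)=\mathbb C1$ and $T(P)(n,m)=\bigoplus_{k_1+\cdots+k_n=m}P(k_1)\otimes\cdots\otimes P(k_n)$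 otherwise; it is a horizontal algebra under concatenation with unit $1$. Gap-insertion operad: $\mathrm{NC}(n)$ is the set of non-crossing partitions of $\{1,\dots,n\}$, $\mathrm{NC}(0)=\{\emptyset\}$, where $\emptyset$ (also written $\{\emptyset\}$) is the empty partition. $\mathcal{NC}(n)$ is the vector space spanned by $\mathrm{NC}(n-1)$, $n\ge1$. A partition $\pi$ of $p$ elements has $|\pi|=p+1$ inputs, its gaps (before $1$, between consecutive elements, after $p$). The operadic composition $\pi\circ(\alpha_1,\dots,\alpha_{|\pi|})$ inserts $\alpha_i$ into the $i$-th gap of $\pi$ (and renumbers); the operadic unit is $\emptyset$. $\nabla:T(\mathcal{NC})\boxtimes T(\mathcal{NC})\to T(\mathcal{NC})$ is the induced horizontal morphism: $\nabla((p^1\cdots p^n)\boxtimes(q_1\cdots q_N))$, with $N=\sum_i|p^i|$, is the word whose $i$-th letter is $p^i$ composed with the consecutive group of $|p^i|$ letters $q_j$ corresponding to it. $\eta:\mathbf 1_v\to T(\mathcal{NC})$ is $\eta(1_n)=\emptyset^n$ (word of $n$ empty partitions). $\Delta$ is the horizontal algebra morphism with $\Delta(\pi)=\sum\alpha\boxtimes\beta$ for a non-crossing partition $\pi$, the sum being over all pairs of a non-crossing partition $\alpha$ and a word $\beta$ on non-crossing partitions with $\nabla(\alpha\boxtimes\beta)=\pi$. $\varepsilon:T(\mathcal{NC})\to\mathbf 1_v$ is the horizontal algebra morphism with $\varepsilon(\emptyset)=1_1$ and $\varepsilon(\pi)=0$ for non-empty $\pi$. $S$ is the horizontal algebra morphism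 with $S(\pi)=(-1)^{\sharp\pi}\pi$ if $\pi$ is an interval partition (all blocks are intervals of consecutive integers; $\emptyset$ is included) and $S(\pi)=0$ otherwise, where $\sharp\pi$ is the number of blocks. *)

(* Defs.v *)
From HB Require Import structures.
From mathcomp Require Import all_boot all_algebra.
From mathcomp Require Import finmap.
From mathcomp Require Import boolp classical_sets fsbigop reals cardinality.
From mathcomp Require Import complex.
From mathcomp Require Import generic_quotient ring_quotient.
From mathcomp Require Import monalg.
From mathcomp Require Import zify.

Set Implicit Arguments.
Unset Strict Implicit.
Unset Printing Implicit Defensive.
Import GRing.Theory.
Local Open Scope ring_scope.

(* {malg K[B]} is used only as the free vector space on the set B, with
   canonical basis the << b >>. *)
Section FreeModule.
Variables (K : fieldType) (B : choiceType) (U : lmodType K) (f : B -> U).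

Definition lin_ext (x : {malg K[B]}) : U :=
  \sum_(b <- msupp x) x@_b *: f b.

Lemma lin_extEw (x : {malg K[B]}) (D : {fset B}) :
  fsubset (msupp x) D -> lin_ext x = \sum_(b <- D) x@_b *: f b.
Proof.
move=> sD; rewrite /lin_ext; apply: big_fset_incl => // b _ /mcoeff_outdom ->.
by rewrite scale0r.
Qed.

Lemma lin_ext_is_linear : linear lin_ext.
Proof.
move=> a x y; set D := fsetU (msupp x) (msupp y).
rewrite (@lin_extEw x D) ?fsubsetUl // (@lin_extEw y D) ?fsubsetUr //.
rewrite (@lin_extEw _ D); last first.
  apply: fsubset_trans (msuppD_le _ _) _; apply: fsetSU; exact: msuppZ_le.
rewrite scaler_sumr -big_split /=; apply: eq_bigr => b _.
by rewrite mcoeffD mcoeffZ scalerDl scalerA.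
Qed.
HB.instance Definition _ :=
  GRing.isLinear.Build K {malg K[B]} U _ lin_ext lin_ext_is_linear.

Lemma lin_extU (b : B) : lin_ext << b >> = f b.
Proof.
rewrite (@lin_extEw _ [fset b]%fset) ?msuppU_le //.
by rewrite big_seq_fset1 mcoeffUU scale1r.
Qed.

Lemma lin_ext_uniq (g : {linear {malg K[B]} -> U}) :
  (forall b, g << b >> = f b) -> g =1 lin_ext.
Proof.
move=> gf x; rewrite {1}(monalgE x) linear_sum; apply: eq_bigr => b _.
suff -> : << x@_b *g b >> = x@_b *: << b >> :> {malg K[B]} by rewrite linearZ /= gf.
by apply/malgP => c; rewrite mcoeffZ !mcoeffU mulr_natr.
Qed.
End FreeModule.

(* For families V, W of vector spaces indexed by I, [dsum V W] is the direct sum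
   over i : I of the tensor products V i (x) W i, presented by generators
   [tgen v w] and the bilinearity relations: generators with different indices
   are subject to no common relation. *)
Section Tensor.
Variables (K : fieldType) (I : choiceType) (V W : I -> lmodType K).

Definition tgen (i : I) (v : V i) (w : W i) : {malg K[{i : I & (V i * W i)%type}]} :=
  << Tagged (fun i => (V i * W i)%type) (v, w) >>.

Inductive tens_rel : {malg K[{i : I & (V i * W i)%type}]} -> Prop :=
| TensRel0 : tens_rel 0
| TensRelP a x y : tens_rel x -> tens_rel y -> tens_rel (a *: x + y)
| TensRelL i a (v v' : V i) (w : W i) :
    tens_rel (tgen (a *: v + v') w - (a *: tgen v w + tgen v' w))
| TensRelR i a (v : V i) (w w' : W i) :
    tens_rel (tgen v (a *: w + w') - (a *: tgen v w + tgen v w')).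

Definition tens_relb : pred {malg K[{i : I & (V i * W i)%type}]} :=
  fun x => `[< tens_rel x >].

Lemma tens_relb_zmod : zmod_closed tens_relb.
Proof.
split=> [|x y /asboolP Rx /asboolP Ry]; apply/asboolP; first exact: TensRel0.
by rewrite -scaleN1r addrC; apply: TensRelP.
Qed.
HB.instance Definition _ := GRing.isZmodClosed.Build {malg K[{i : I & (V i * W i)%type}]} tens_relb tens_relb_zmod.

Definition tens_relN : zmodClosed {malg K[{i : I & (V i * W i)%type}]} :=
  GRing.ZmodClosed.clone _ tens_relb _.

Definition dtens : Type := Quotient.quot tens_relN.
HB.instance Definition _ := GRing.Zmodule.on dtens.
Definition dtens_pi (x : {malg K[{i : I & (V i * W i)%type}]}) : dtens :=
  \pi_(Quotient.quot tens_relN)%qT x.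

Lemma dtens_piB : {morph dtens_pi : x y / x - y}.
Proof. by move=> x y; rewrite /dtens_pi raddfB. Qed.
HB.instance Definition _ := GRing.isZmodMorphism.Build _ _ dtens_pi dtens_piB.

Lemma dtens_piP x y : (dtens_pi x = dtens_pi y) <-> tens_rel (x - y).
Proof.
split=> [/eqP|R]; first by rewrite -Quotient.idealrBE => /asboolP.
by apply/eqP; rewrite -Quotient.idealrBE; apply/asboolP.
Qed.
Definition dtens_repr (x : dtens) : {malg K[{i : I & (V i * W i)%type}]} :=
  repr (x : Quotient.quot tens_relN).
Lemma dtens_reprK : cancel dtens_repr dtens_pi.
Proof. exact: reprK. Qed.

Definition dtens_scale (a : K) (x : dtens) : dtens :=
  dtens_pi (a *: dtens_repr x).

Lemma dtens_piZ a x : dtens_pi (a *: x) = dtens_scale a (dtens_pi x).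
Proof.
apply/dtens_piP; rewrite -scalerBr -[_ *: _]addr0; apply: TensRelP (TensRel0).
by apply/dtens_piP; rewrite dtens_reprK.
Qed.
Lemma dtens_scaleA a b x : dtens_scale a (dtens_scale b x) = dtens_scale (a * b) x.
Proof. by rewrite -(dtens_reprK x) -!dtens_piZ scalerA. Qed.
Lemma dtens_scale1 : left_id 1 dtens_scale.
Proof. by move=> x; rewrite -(dtens_reprK x) -!dtens_piZ scale1r. Qed.
Lemma dtens_scaleDr : right_distributive dtens_scale +%R.
Proof.
move=> a x y; rewrite -(dtens_reprK x) -(dtens_reprK y) -raddfD -!dtens_piZ.
by rewrite scalerDr raddfD.
Qed.
Lemma dtens_scaleDl x : {morph dtens_scale^~ x : a b / a + b}.
Proof.
by move=> a b; rewrite -(dtens_reprK x) -!dtens_piZ scalerDl raddfD.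
Qed.
HB.instance Definition _ := GRing.Zmodule_isLmodule.Build K dtens
  dtens_scaleA dtens_scale1 dtens_scaleDr dtens_scaleDl.

Lemma dtens_pi_scalable : scalable dtens_pi.
Proof. exact: dtens_piZ. Qed.
HB.instance Definition _ := GRing.isScalable.Build _ _ _ _ dtens_pi dtens_pi_scalable.

Definition dsum : lmodType K := dtens.

Definition dpure (i : I) (v : V i) (w : W i) : dsum := dtens_pi (tgen v w).

Lemma dpurel i a (v v' : V i) (w : W i) :
  dpure (a *: v + v') w = a *: dpure v w + dpure v' w.
Proof. by rewrite -linearP; apply/dtens_piP; apply: TensRelL. Qed.

Lemma dpurer i a (v : V i) (w w' : W i) :
  dpure v (a *: w + w') = a *: dpure v w + dpure v w'.
Proof. by rewrite -linearP; apply/dtens_piP; apply: TensRelR. Qed.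

Lemma dsum_span (x : dsum) :
  exists s : seq {i : I & (V i * W i)%type},
    x = \sum_(t <- s) dpure (tagged t).1 (tagged t).2.
Proof.
rewrite -(dtens_reprK x) (monalgE (dtens_repr x)) raddf_sum /=.
elim: (X in \sum_(k <- X) _) => [|k r [s IHs]].
  by exists [::]; rewrite !big_nil.
case: k => i [v w].
set b := (dtens_repr x)@_(Tagged (fun i => (V i * W i)%type) (v, w)).
exists (Tagged (fun i => (V i * W i)%type) (b *: v, w) :: s).
rewrite !big_cons IHs; congr (_ + _) => /=.
have := dpurel b v 0 w; rewrite addr0.
have -> : dpure (0 : V i) w = 0.
  by have := dpurel (-1) (0 : V i) 0 w; rewrite scaler0 addr0 scaleN1r addNr.
rewrite addr0 => ->; rewrite /dpure -linearZ /=; congr dtens_pi.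
by apply/malgP => k; rewrite mcoeffZ !mcoeffU mulr_natr.
Qed.

Lemma dsum_ind (P : dsum -> Prop) : P 0 ->
  (forall x y, P x -> P y -> P (x + y)) ->
  (forall i (v : V i) (w : W i), P (dpure v w)) -> forall x, P x.
Proof.
move=> P0 PD Pp x; have [s ->] := dsum_span x.
by apply: big_ind => // t _; apply: Pp.
Qed.

Section Lift.
Variable U : lmodType K.

Record bilin := Bilin {
  bfun :> forall i, V i -> W i -> U;
  bfunl : forall i (w : W i), linear (fun v : V i => bfun v w);
  bfunr : forall i (v : V i), linear (bfun v) }.

Variable f : bilin.
Definition tgen_lift (x : {malg K[{i : I & (V i * W i)%type}]}) : U :=
  lin_ext (fun t => f (tag t) (tagged t).1 (tagged t).2) x.

Definition dlift_fun (x : dsum) : U := tgen_lift (dtens_repr x).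

Lemma tgen_lift_rel x : tens_rel x -> tgen_lift x = 0.
Proof.
rewrite /tgen_lift; elim=> [|a y z _ Ey _ Ez|i a v v' w|i a v w w'].
- by rewrite linear0.
- by rewrite linearP /= Ey Ez scaler0 addr0.
- by rewrite linearB linearP /= !lin_extU /= bfunl subrr.
- by rewrite linearB linearP /= !lin_extU /= bfunr subrr.
Qed.

Lemma dlift_pi x : dlift_fun (dtens_pi x) = tgen_lift x.
Proof.
apply/eqP; rewrite -subr_eq0 /dlift_fun /tgen_lift -linearB; apply/eqP.
by apply: tgen_lift_rel; apply/dtens_piP; rewrite dtens_reprK.
Qed.

Lemma dlift_linear : linear dlift_fun.
Proof.
move=> a x y; rewrite -(dtens_reprK x) -(dtens_reprK y) -linearP !dlift_pi.
by rewrite /tgen_lift linearP.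
Qed.
HB.instance Definition _ :=
  GRing.isLinear.Build K dsum U _ dlift_fun dlift_linear.

Definition dlift : {linear dsum -> U} := dlift_fun.

Lemma dliftE i (v : V i) (w : W i) : dlift (dpure v w) = f i v w.
Proof. by rewrite [LHS]dlift_pi /tgen_lift lin_extU. Qed.

Lemma dlift_uniq (g : {linear dsum -> U}) :
  (forall i (v : V i) (w : W i), g (dpure v w) = f i v w) -> g =1 dlift.
Proof.
move=> gf; apply: dsum_ind => [|x y gx gy|i v w]; first by rewrite !linear0.
  by rewrite !linearD gx gy.
by rewrite gf dliftE.
Qed.
End Lift.
End Tensor.
(* dpurel, dpurer, dsum_ind and dliftE are a complete interface; opacity only
   keeps unification from unfolding the quotient. *)
#[global] Opaque dsum dpure dlift.

Arguments dpure {K I V W} i v w.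

(* P n m: n outputs, m inputs. *)
Definition bicoll (K : fieldType) := nat -> nat -> lmodType K.
Identity Coercion fun_of_bicoll : bicoll >-> Funclass.

Definition hom (K : fieldType) (P Q : bicoll K) :=
  forall n m, {linear P n m -> Q n m}.

Definition eqhom (K : fieldType) (P Q : bicoll K) (f g : hom P Q) :=
  forall n m, f n m =1 g n m.

Definition idhom (K : fieldType) (P : bicoll K) : hom P P := fun n m => idfun.
Definition comphom (K : fieldType) (P Q S : bicoll K) (g : hom Q S) (f : hom P Q)
  : hom P S := fun n m => g n m \o f n m.


Lemma dlift_lin (K : fieldType) (I : choiceType) (V W : I -> lmodType K)
    (U : lmodType K) (f f1 f2 : bilin V W U) a :
  (forall i v w, f i v w = a *: f1 i v w + f2 i v w) ->
  forall x, dlift f x = a *: dlift f1 x + dlift f2 x.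
Proof.
move=> E; apply: dsum_ind => [|x y Ex Ey|i v w].
- by rewrite !linear0 ?scaler0 addr0.
- by rewrite !linearD /= Ex Ey addrACA.
- by rewrite !dliftE E.
Qed.

Section BilinExt.
Variables (K : fieldType) (B1 B2 : choiceType) (U : lmodType K).
Variable f : B1 -> B2 -> U.
Definition lin_ext2 (x : {malg K[B1]}) (y : {malg K[B2]}) : U :=
  lin_ext (fun b => lin_ext (f b) y) x.

Lemma lin_ext2l y : linear (lin_ext2^~ y).
Proof. by move=> a x x'; rewrite /lin_ext2 linearP. Qed.

Lemma lin_ext2r x : linear (lin_ext2 x).
Proof.
move=> a y y'; rewrite /lin_ext2 /lin_ext scaler_sumr -big_split /=.
apply: eq_bigr => b _; rewrite -!/(lin_ext _ _) linearP /= scalerDr !scalerA.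
by rewrite mulrC.
Qed.

Lemma lin_ext2U b c : lin_ext2 << b >> << c >> = f b c.
Proof. by rewrite /lin_ext2 !lin_extU. Qed.
End BilinExt.

Local Obligation Tactic := idtac.

Section Products.
Variable K : fieldType.
Implicit Types P Q S : bicoll K.

Definition vtens P Q : bicoll K :=
  fun n m => dsum (fun k => P n k) (fun k => Q k m).

Definition vpure P Q n k m (p : P n k) (q : Q k m) : vtens P Q n m :=
  dpure k p q.

(* ((n1, m1), (n2, m2)) with n1 + n2 = n and m1 + m2 = m. *)
Definition hidx (n m : nat) :=
  {x : (nat * nat) * (nat * nat) |
     (x.1.1 + x.2.1 == n)%N && (x.1.2 + x.2.2 == m)%N}.

Definition htens P Q : bicoll K := fun n m =>
  dsum (fun x : hidx n m => P (val x).1.1 (val x).1.2)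
        (fun x : hidx n m => Q (val x).2.1 (val x).2.2).

Lemma hidxP n1 m1 n2 m2 n m : (n1 + n2)%N = n -> (m1 + m2)%N = m ->
  (n1 + n2 == n)%N && (m1 + m2 == m)%N.
Proof. by move=> -> ->; rewrite !eqxx. Qed.

Lemma hidx_n n m (x : hidx n m) : ((val x).1.1 + (val x).2.1)%N = n.
Proof. by case/andP: (valP x) => /eqP. Qed.

Lemma hidx_m n m (x : hidx n m) : ((val x).1.2 + (val x).2.2)%N = m.
Proof. by case/andP: (valP x) => _ /eqP. Qed.

(* The equalities are arguments so that no transport along n1 + n2 = n is
   needed, e.g. in the associator. *)
Definition hpure P Q n1 m1 n2 m2 n m (en : (n1 + n2)%N = n)
    (em : (m1 + m2)%N = m) (p : P n1 m1) (q : Q n2 m2) : htens P Q n m :=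
  dpure (exist _ ((n1, m1), (n2, m2)) (hidxP en em) : hidx n m) p q.

Lemma vpurel P Q n k m a (p p' : P n k) (q : Q k m) :
  vpure (a *: p + p') q = a *: vpure p q + vpure p' q.
Proof. exact: dpurel. Qed.
Lemma vpurer P Q n k m a (p : P n k) (q q' : Q k m) :
  vpure p (a *: q + q') = a *: vpure p q + vpure p q'.
Proof. exact: dpurer. Qed.
Lemma hpurel P Q n1 m1 n2 m2 n m (en : (n1 + n2)%N = n) (em : (m1 + m2)%N = m)
    a (p p' : P n1 m1) (q : Q n2 m2) :
  hpure en em (a *: p + p') q = a *: hpure en em p q + hpure en em p' q.
Proof. exact: dpurel. Qed.
Lemma hpurer P Q n1 m1 n2 m2 n m (en : (n1 + n2)%N = n) (em : (m1 + m2)%N = m)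
    a (p : P n1 m1) (q q' : Q n2 m2) :
  hpure en em p (a *: q + q') = a *: hpure en em p q + hpure en em p q'.
Proof. exact: dpurer. Qed.

Section Maps.
Variables (P P' Q Q' : bicoll K) (f : hom P P') (g : hom Q Q') (n m : nat).

Program Definition vmap_bilin : bilin (fun k => P n k) (fun k => Q k m)
    (vtens P' Q' n m) :=
  Bilin (bfun := fun k p q => vpure (f n k p) (g k m q)) _ _.
Next Obligation. by move=> k q a p p'; rewrite linearP vpurel. Qed.
Next Obligation. by move=> k p a q q'; rewrite linearP vpurer. Qed.

Program Definition hmap_bilin :
    bilin (fun x : hidx n m => P (val x).1.1 (val x).1.2)
          (fun x : hidx n m => Q (val x).2.1 (val x).2.2) (htens P' Q' n m) :=
  Bilin (bfun := fun x p q => hpure (hidx_n x) (hidx_m x) (f _ _ p) (g _ _ q)) _ _.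
Next Obligation. by move=> x q a p p'; rewrite linearP hpurel. Qed.
Next Obligation. by move=> x p a q q'; rewrite linearP hpurer. Qed.
End Maps.

Definition vmap P P' Q Q' (f : hom P P') (g : hom Q Q') :
  hom (vtens P Q) (vtens P' Q') := fun n m => dlift (vmap_bilin f g n m).
Definition hmap P P' Q Q' (f : hom P P') (g : hom Q Q') :
  hom (htens P Q) (htens P' Q') := fun n m => dlift (hmap_bilin f g n m).

Section Assoc.
Variables (P Q S : bicoll K) (n m : nat).

Program Definition vassoc_in k (s : S k m) :
    bilin (fun l => P n l) (fun l => Q l k) (vtens P (vtens Q S) n m) :=
  Bilin (bfun := fun l p q => vpure p (vpure q s)) _ _.
Next Obligation. by move=> k s l q a p p'; rewrite vpurel. Qed.
Next Obligation. by move=> k s l p a q q'; rewrite vpurel vpurer. Qed.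

Program Definition vassoc_bilin :
    bilin (fun k => vtens P Q n k) (fun k => S k m) (vtens P (vtens Q S) n m) :=
  Bilin (bfun := fun k x s => dlift (vassoc_in s) x) _ _.
Next Obligation. by move=> k s a x x'; rewrite linearP. Qed.
Next Obligation.
move=> k x a s s'; apply: dlift_lin => l p q /=.
by rewrite !vpurer.
Qed.

Lemma hassoc_n (x : hidx n m) (y : hidx (val x).1.1 (val x).1.2) :
  ((val y).1.1 + ((val y).2.1 + (val x).2.1))%N = n.
Proof. by rewrite addnA (hidx_n y) (hidx_n x). Qed.
Lemma hassoc_m (x : hidx n m) (y : hidx (val x).1.1 (val x).1.2) :
  ((val y).1.2 + ((val y).2.2 + (val x).2.2))%N = m.
Proof. by rewrite addnA (hidx_m y) (hidx_m x). Qed.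

Program Definition hassoc_in (x : hidx n m) (s : S (val x).2.1 (val x).2.2) :
    bilin (fun y : hidx (val x).1.1 (val x).1.2 => P (val y).1.1 (val y).1.2)
          (fun y : hidx (val x).1.1 (val x).1.2 => Q (val y).2.1 (val y).2.2)
          (htens P (htens Q S) n m) :=
  Bilin (bfun := fun y p q => hpure (hassoc_n y) (hassoc_m y) p
                                (hpure erefl erefl q s)) _ _.
Next Obligation. by move=> x s y q a p p'; rewrite hpurel. Qed.
Next Obligation. by move=> x s y p a q q'; rewrite hpurel hpurer. Qed.

Program Definition hassoc_bilin :
    bilin (fun x : hidx n m => htens P Q (val x).1.1 (val x).1.2)
          (fun x : hidx n m => S (val x).2.1 (val x).2.2)
          (htens P (htens Q S) n m) :=
  Bilin (bfun := fun x t s => dlift (hassoc_in s) t) _ _.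
Next Obligation. by move=> x s a t t'; rewrite linearP. Qed.
Next Obligation.
move=> x t a s s'; apply: dlift_lin => y p q /=.
by rewrite !hpurer.
Qed.
End Assoc.

Definition vassoc P Q S : hom (vtens (vtens P Q) S) (vtens P (vtens Q S)) :=
  fun n m => dlift (vassoc_bilin P Q S n m).
Definition hassoc P Q S : hom (htens (htens P Q) S) (htens P (htens Q S)) :=
  fun n m => dlift (hassoc_bilin P Q S n m).

Section Exchange.
Variables (C1 C2 C3 C4 : bicoll K) (n m : nat).
Variable x : hidx n m.
Let U := vtens (htens C1 C3) (htens C2 C4) n m.

Program Definition exch_in2 k (p1 : C1 (val x).1.1 k) (p2 : C2 k (val x).1.2) :
    bilin (fun l => C3 (val x).2.1 l) (fun l => C4 l (val x).2.2) U :=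
  Bilin (bfun := fun l p3 p4 =>
    vpure (hpure (hidx_n x) erefl p1 p3) (hpure erefl (hidx_m x) p2 p4)) _ _.
Next Obligation. by move=> k p1 p2 l p4 a p3 p3'; rewrite hpurer vpurel. Qed.
Next Obligation. by move=> k p1 p2 l p3 a p4 p4'; rewrite hpurer vpurer. Qed.

Program Definition exch_in1 (z : vtens C3 C4 (val x).2.1 (val x).2.2) :
    bilin (fun k => C1 (val x).1.1 k) (fun k => C2 k (val x).1.2) U :=
  Bilin (bfun := fun k p1 p2 => dlift (exch_in2 p1 p2) z) _ _.
Next Obligation.
move=> z k p2 a p1 p1'; apply: dlift_lin => l p3 p4 /=.
by rewrite hpurel vpurel.
Qed.
Next Obligation.
move=> z k p1 a p2 p2'; apply: dlift_lin => l p3 p4 /=.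
by rewrite hpurel vpurer.
Qed.
End Exchange.

Program Definition exch_bilin (C1 C2 C3 C4 : bicoll K) n m :
    bilin (fun x : hidx n m => vtens C1 C2 (val x).1.1 (val x).1.2)
          (fun x : hidx n m => vtens C3 C4 (val x).2.1 (val x).2.2)
          (vtens (htens C1 C3) (htens C2 C4) n m) :=
  Bilin (bfun := fun x y z => dlift (exch_in1 C1 C2 z) y) _ _.
Next Obligation. by move=> ? ? ? ? ? ? x z a y y'; rewrite linearP. Qed.
Next Obligation.
move=> ? ? ? ? ? ? x y a z z'; apply: dlift_lin => k p1 p2 /=.
by rewrite linearP.
Qed.

Definition exchange (C1 C2 C3 C4 : bicoll K) :
  hom (htens (vtens C1 C2) (vtens C3 C4)) (vtens (htens C1 C3) (htens C2 C4)) :=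
  fun n m => dlift (exch_bilin C1 C2 C3 C4 n m).

Lemma hpure_irr (P Q : bicoll K) n1 m1 n2 m2 n m (en en' : (n1 + n2)%N = n)
    (em em' : (m1 + m2)%N = m) (p : P n1 m1) (q : Q n2 m2) :
  hpure en em p q = hpure en' em' p q.
Proof. by rewrite (eq_irrelevance en en') (eq_irrelevance em em'). Qed.

Lemma vassocE (P Q S : bicoll K) n l k m (p : P n l) (q : Q l k) (s : S k m) :
  vassoc P Q S n m (vpure (vpure p q) s) = vpure p (vpure q s).
Proof. by rewrite /vassoc /vpure !dliftE /= !dliftE. Qed.

Lemma hassocE (P Q S : bicoll K) n1 m1 n2 m2 n3 m3 n12 m12 n23 m23 n m
    (en : (n12 + n3)%N = n) (em : (m12 + m3)%N = m)
    (en12 : (n1 + n2)%N = n12) (em12 : (m1 + m2)%N = m12)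
    (en' : (n1 + n23)%N = n) (em' : (m1 + m23)%N = m)
    (en23 : (n2 + n3)%N = n23) (em23 : (m2 + m3)%N = m23)
    (p : P n1 m1) (q : Q n2 m2) (s : S n3 m3) :
  hassoc P Q S n m (hpure en em (hpure en12 em12 p q) s) =
  hpure en' em' p (hpure en23 em23 q s).
Proof.
subst n23 m23; rewrite /hassoc {1 2}/hpure !dliftE /= !dliftE /=.
exact: hpure_irr.
Qed.

Lemma exchangeE (C1 C2 C3 C4 : bicoll K) n1 k1 m1 n2 k2 m2 n m
    (en : (n1 + n2)%N = n) (em : (m1 + m2)%N = m)
    (p1 : C1 n1 k1) (p2 : C2 k1 m1) (p3 : C3 n2 k2) (p4 : C4 k2 m2) :
  exchange C1 C2 C3 C4 n m (hpure en em (vpure p1 p2) (vpure p3 p4)) =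
  vpure (hpure en erefl p1 p3) (hpure erefl em p2 p4).
Proof.
rewrite /exchange {1}/hpure !dliftE /= /vpure !dliftE /= !dliftE /=.
exact: (f_equal2 (@vpure (htens C1 C3) (htens C2 C4) n (k1 + k2)%N m)
  (hpure_irr _ _ _ _ _ _) (hpure_irr _ _ _ _ _ _)).
Qed.

(* 'rV[K]_b with b : bool is K when b is true and 0 otherwise; the generators
   1_0 of 1_h and 1_n of 1_v are the row vectors (1). *)
Definition hunit : bicoll K := fun n m => 'rV[K]_((n == 0) && (m == 0))%N.
Definition vunit : bicoll K := fun n m => 'rV[K]_(n == m)%N.

Definition hone1 : hunit 0 0 := const_mx 1.
Definition vone1 n : vunit n n := const_mx 1.

Definition tot (b : bool) (x : 'rV[K]_b) : K := \sum_j x 0 j.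
Lemma tot_linear b : scalar (@tot b).
Proof.
move=> a x y; rewrite /tot mulr_sumr -big_split /=; apply: eq_bigr => j _.
by rewrite !mxE.
Qed.
HB.instance Definition _ (b : bool) := GRing.isLinear.Build K 'rV[K]_b K _ (@tot b) (@tot_linear b).

Section UnitMaps.
Variable P : bicoll K.

(* hunit_map e : 1_h -> P maps 1_0 to e; vunit_map e : 1_v -> P maps 1_n to e n. *)
Definition hunit_val (e : P 0%N 0%N) n m : P n m :=
  match n, m return P n m with 0%N, 0%N => e | _, _ => 0 end.
Definition vunit_val (e : forall n, P n n) n m : P n m :=
  match n =P m with
  | ReflectT E => ecast k (P n k) E (e n)
  | ReflectF _ => 0
  end.
Definition scale_tot n m (p : P n m) (b : bool) (x : 'rV[K]_b) : P n m :=
  tot x *: p.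
Lemma scale_tot_linear n m p b : linear (@scale_tot n m p b).
Proof. by move=> a x y; rewrite /scale_tot linearP /= scalerDl scalerA. Qed.
HB.instance Definition _ n m p (b : bool) :=
  GRing.isLinear.Build K 'rV[K]_b (P n m) _ (@scale_tot n m p b) (@scale_tot_linear n m p b).

Definition hunit_map (e : P 0%N 0%N) : hom hunit P :=
  fun n m => @scale_tot n m (hunit_val e n m) _.
Definition vunit_map (e : forall n, P n n) : hom vunit P :=
  fun n m => @scale_tot n m (vunit_val e n m) _.

(* The unitors are used in the direction P -> 1 (x) P, P -> P (x) 1. *)
Definition hlam_fun n m (p : P n m) : htens hunit P n m :=
  hpure (add0n n) (add0n m) hone1 p.
Definition hrho_fun n m (p : P n m) : htens P hunit n m :=
  hpure (addn0 n) (addn0 m) p hone1.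
Definition vlam_fun n m (p : P n m) : vtens vunit P n m := vpure (vone1 n) p.
Definition vrho_fun n m (p : P n m) : vtens P vunit n m := vpure p (vone1 m).
Lemma hlam_linear n m : linear (@hlam_fun n m).
Proof. by move=> a p q; apply: hpurer. Qed.
Lemma hrho_linear n m : linear (@hrho_fun n m).
Proof. by move=> a p q; apply: hpurel. Qed.
Lemma vlam_linear n m : linear (@vlam_fun n m).
Proof. by move=> a p q; apply: vpurer. Qed.
Lemma vrho_linear n m : linear (@vrho_fun n m).
Proof. by move=> a p q; apply: vpurel. Qed.
HB.instance Definition _ n m := GRing.isLinear.Build K (P n m)
  (htens hunit P n m) _ (@hlam_fun n m) (@hlam_linear n m).
HB.instance Definition _ n m := GRing.isLinear.Build K (P n m)
  (htens P hunit n m) _ (@hrho_fun n m) (@hrho_linear n m).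
HB.instance Definition _ n m := GRing.isLinear.Build K (P n m)
  (vtens vunit P n m) _ (@vlam_fun n m) (@vlam_linear n m).
HB.instance Definition _ n m := GRing.isLinear.Build K (P n m)
  (vtens P vunit n m) _ (@vrho_fun n m) (@vrho_linear n m).

Definition hlam : hom P (htens hunit P) := fun n m => @hlam_fun n m.
Definition hrho : hom P (htens P hunit) := fun n m => @hrho_fun n m.
Definition vlam : hom P (vtens vunit P) := fun n m => @vlam_fun n m.
Definition vrho : hom P (vtens P vunit) := fun n m => @vrho_fun n m.
End UnitMaps.
End Products.

Section Structures.
Variable K : fieldType.

(* The data of a monoidal structure on bicollections; ts_lam and ts_rho are the
   inverses of the usual unitors. *)
Record tensor_struct := TensorStruct {
  ts_obj : bicoll K -> bicoll K -> bicoll K;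
  ts_map : forall P P' Q Q',
    hom P P' -> hom Q Q' -> hom (ts_obj P Q) (ts_obj P' Q');
  ts_unit : bicoll K;
  ts_assoc : forall P Q S,
    hom (ts_obj (ts_obj P Q) S) (ts_obj P (ts_obj Q S));
  ts_lam : forall P, hom P (ts_obj ts_unit P);
  ts_rho : forall P, hom P (ts_obj P ts_unit) }.

Definition htensor : tensor_struct :=
  TensorStruct (@hmap K) (@hassoc K) (@hlam K) (@hrho K).
Definition vtensor : tensor_struct :=
  TensorStruct (@vmap K) (@vassoc K) (@vlam K) (@vrho K).

Definition is_monoid (D : tensor_struct) (A : bicoll K)
    (mul : hom (ts_obj D A A) A) (one : hom (ts_unit D) A) : Prop :=
  [/\ eqhom (comphom mul (ts_map D mul (idhom A)))
            (comphom mul (comphom (ts_map D (idhom A) mul) (ts_assoc D A A A))),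
      eqhom (comphom mul (comphom (ts_map D one (idhom A)) (ts_lam D A)))
            (idhom A)
    & eqhom (comphom mul (comphom (ts_map D (idhom A) one) (ts_rho D A)))
            (idhom A)].

Definition is_comonoid (D : tensor_struct) (C : bicoll K)
    (cop : hom C (ts_obj D C C)) (cou : hom C (ts_unit D)) : Prop :=
  [/\ eqhom (comphom (ts_assoc D C C C) (comphom (ts_map D cop (idhom C)) cop))
            (comphom (ts_map D (idhom C) cop) cop),
      eqhom (comphom (ts_map D cou (idhom C)) cop) (ts_lam D C)
    & eqhom (comphom (ts_map D (idhom C) cou) cop) (ts_rho D C)].

(* The data of a horizontal algebra; the axioms are is_halg. *)
Record halg := Halg {
  hcar :> bicoll K;
  hmul : hom (htens hcar hcar) hcar;
  hone : hom (hunit K) hcar }.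

Definition is_halg (A : halg) : Prop :=
  is_monoid (D := htensor) (hmul A) (hone A).

Definition is_halg_hom (A B : halg) (f : hom A B) : Prop :=
  eqhom (comphom f (hmul A)) (comphom (hmul B) (hmap f f)) /\
  eqhom (comphom f (hone A)) (hone B).

Definition hunit_split : hom (hunit K) (vtens (hunit K) (hunit K)) :=
  hunit_map (vpure (hone1 K) (hone1 K)).

Definition vprod_halg (A B : halg) : halg :=
  Halg (comphom (vmap (hmul A) (hmul B)) (@exchange K A B A B))
       (comphom (vmap (hone A) (hone B)) hunit_split).

Section VunitMul.
Variables n m : nat.
Program Definition vunit_mul_bilin :
    bilin (fun x : hidx n m => vunit K (val x).1.1 (val x).1.2)
          (fun x : hidx n m => vunit K (val x).2.1 (val x).2.2)
          (vunit K n m) :=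
  Bilin (bfun := fun x p q => (tot p * tot q) *: const_mx 1) _ _.
Next Obligation.
by move=> x q a p p'; rewrite linearP mulrDl -mulrA scalerDl scalerA.
Qed.
Next Obligation.
by move=> x p a q q'; rewrite linearP mulrDr mulrCA scalerDl scalerA.
Qed.
End VunitMul.

Definition vunit_halg : halg :=
  @Halg (vunit K) (fun n m => dlift (vunit_mul_bilin n m))
    (hunit_map (vone1 K 0)).

(* A monoid (resp. comonoid) in (Alg_h, vtens, 1_v) is a monoid (resp. comonoid)
   for vtens whose structure maps are horizontal algebra morphisms. *)
Definition is_pros (A : halg) (nab : hom (vtens A A) A)
    (eta : hom (vunit K) A) : Prop :=
  [/\ is_halg A,
      is_halg_hom (A := vprod_halg A A) (B := A) nab,
      is_halg_hom (A := vunit_halg) (B := A) eta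
    & is_monoid (D := vtensor) nab eta].

Definition is_bialg (A : halg) (cop : hom A (vtens A A))
    (cou : hom A (vunit K)) : Prop :=
  [/\ is_halg A,
      is_halg_hom (A := A) (B := vprod_halg A A) cop,
      is_halg_hom (A := A) (B := vunit_halg) cou
    & is_comonoid (D := vtensor) cop cou].

Definition is_hopf (A : halg) (cop : hom A (vtens A A)) (nab : hom (vtens A A) A)
    (S : hom A A) (cou : hom A (vunit K)) (eta : hom (vunit K) A) : Prop :=
  [/\ is_bialg cop cou,
      is_pros nab eta,
      is_halg_hom S,
      eqhom (comphom nab (comphom (vmap S (idhom A)) cop)) (comphom eta cou)
    & eqhom (comphom nab (comphom (vmap (idhom A) S) cop)) (comphom eta cou)].

Lemma lin_comb3 (V : lmodType K) a (x x' y y' z z' : V) :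
  a *: x + x' - (a *: y + y') - (a *: z + z') =
  a *: (x - y - z) + (x' - y' - z').
Proof. by rewrite !scalerBr !opprD (addrACA (a *: x)) [LHS](addrACA (a *: x - a *: y)). Qed.

Section Conilpotent.
Variables (C : bicoll K) (one : forall n, C n n) (cop : hom C (vtens C C)).

(* Only the values for n != m matter; the value 0 on C n n is a convention,
   which makes the iterates of the reduced coproduct maps defined on C. *)
Definition cop_red_fun n m (c : C n m) : vtens C C n m :=
  if n == m then 0 else cop n m c - vpure (one n) c - vpure c (one m).
Lemma cop_red_linear n m : linear (@cop_red_fun n m).
Proof.
move=> a c c'; rewrite /cop_red_fun; case: eqP => _; first by rewrite scaler0 addr0.
by rewrite linearP vpurel vpurer lin_comb3.
Qed.
HB.instance Definition _ n m :=
  GRing.isLinear.Build K (C n m) (vtens C C n m) _ (@cop_red_fun n m)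
    (@cop_red_linear n m).
Definition cop_red : hom C (vtens C C) := fun n m => @cop_red_fun n m.

Fixpoint vpow (r : nat) : bicoll K :=
  if r is r'.+1 then vtens (vpow r') C else C.

(* (... ((cop_red (x) id) o cop_red) ...) : C -> C^(r+1), with cop_red applied
   r times. *)
Fixpoint cop_red_iter (r : nat) : hom C (vpow r) :=
  if r is r'.+1 return hom C (vpow r)
  then comphom (vmap (cop_red_iter r') (idhom C)) cop_red
  else idhom C.

(* x lies in the sum of the C n k (x) C k m over k different from n and m. *)
Definition in_middle n m (x : vtens C C n m) : Prop :=
  exists s : seq {k : nat & (C n k * C k m)%type},
    all (fun t => (tag t != n) && (tag t != m)) s /\
    x = \sum_(t <- s) vpure (tagged t).1 (tagged t).2.
End Conilpotent.

Definition is_conilpotent (C : bicoll K) (cop : hom C (vtens C C)) : Prop :=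
  exists one : forall n, C n n,
    [/\ (forall n, one n != 0 /\ forall x : C n n, exists a, x = a *: one n),
        (forall m, (0 < m)%N ->
           (forall x : C 0%N m, x = 0) /\ (forall x : C m 0%N, x = 0)),
        (forall n, cop n n (one n) = vpure (one n) (one n)),
        (forall n m (c : C n m), n != m -> in_middle (cop_red one cop n m c))
      & (forall n m (c : C n m), n != m ->
           exists r, cop_red_iter one cop r n m c = 0)].
End Structures.

(* Words on an alphabet B whose letter b has ar b inputs (and one output).
   [words n m] has as basis the words of n letters with m inputs in total: it is
   T(P)(n,m) for the collection P with P(k) the span of the letters with k
   inputs, the word b_1 ... b_n standing for b_1 (x) ... (x) b_n. *)
Section Words.
Variables (K : fieldType) (B : choiceType) (ar : B -> nat).

Definition inputs (w : seq B) : nat := sumn (map ar w).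

Definition word (n m : nat) := {w : seq B | (size w == n) && (inputs w == m)}.

Definition mkword n m (w : seq B) (en : size w = n) (em : inputs w = m) :
  word n m := exist _ w (introT andP (conj (introT eqP en) (introT eqP em))).

Lemma word_n n m (w : word n m) : size (val w) = n.
Proof. by case/andP: (valP w) => /eqP. Qed.
Lemma word_m n m (w : word n m) : inputs (val w) = m.
Proof. by case/andP: (valP w) => _ /eqP. Qed.

Definition words : bicoll K := fun n m => {malg K[word n m]}.

Lemma wcat_n n1 m1 n2 m2 n (u : word n1 m1) (v : word n2 m2) :
  (n1 + n2)%N = n -> size (val u ++ val v) = n.
Proof. by rewrite size_cat !word_n. Qed.
Lemma wcat_m n1 m1 n2 m2 m (u : word n1 m1) (v : word n2 m2) :
  (m1 + m2)%N = m -> inputs (val u ++ val v) = m.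
Proof. by rewrite /inputs map_cat sumn_cat -!/(inputs _) !word_m. Qed.

Definition wcat n1 m1 n2 m2 n m (en : (n1 + n2)%N = n) (em : (m1 + m2)%N = m)
    (u : word n1 m1) (v : word n2 m2) : word n m :=
  mkword (wcat_n u v en) (wcat_m u v em).

Lemma letter_m (b : B) : inputs [:: b] = ar b.
Proof. exact: addn0. Qed.
Definition letter (b : B) : word 1 (ar b) := mkword erefl (letter_m b).

Section WordsMul.
Variables n m : nat.
Program Definition words_mul_bilin :
    bilin (fun x : hidx n m => words (val x).1.1 (val x).1.2)
          (fun x : hidx n m => words (val x).2.1 (val x).2.2)
          (words n m) :=
  Bilin (bfun := fun x =>
    lin_ext2 (fun u v => << wcat (hidx_n x) (hidx_m x) u v >>)) _ _.
Next Obligation. by move=> x y; apply: lin_ext2l. Qed.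
Next Obligation. by move=> x y; apply: lin_ext2r. Qed.
End WordsMul.

Definition words_halg : halg K :=
  @Halg K words (fun n m => dlift (words_mul_bilin n m))
    (hunit_map (<< mkword (erefl : size [::] = 0%N) erefl >> : words 0 0)).

(* The horizontal algebra morphism words -> A with value f b on the letter b:
   b_1 ... b_n is sent to the product f b_1 ... f b_n in A. *)
Section Extension.
Variables (A : halg K) (f : forall b, A 1%N (ar b)).

Fixpoint wext (w : seq B) : forall n m, size w = n -> inputs w = m -> A n m :=
  match w return forall n m, size w = n -> inputs w = m -> A n m with
  | [::] => fun n m _ _ => hone A n m (const_mx 1)
  | b :: w' => fun n m en em =>
      hmul A n m (hpure (en : (1 + size w')%N = n) em (f b)
                    (wext (w := w') erefl erefl))
  end.

Definition words_ext : hom words A := fun n m =>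
  lin_ext (fun w : word n m => wext (word_n w) (word_m w)).
End Extension.
End Words.


(* Partitions of {0, ..., p-1} rather than {1, ..., p}. *)
Definition noncrossing (P : {fset {fset nat}}) : Prop :=
  forall (U V : {fset nat}) (a b c d : nat), U \in P -> V \in P ->
    a \in U -> b \in V -> c \in U -> d \in V ->
    (a < b)%N -> (b < c)%N -> (c < d)%N -> U = V.

Definition is_ncpart (p : nat) (P : {fset {fset nat}}) : bool :=
  [&& fcover P == [fset x in iota 0 p]%fset, trivIfset P, fset0 \notin P
    & `[< noncrossing P >] ].

Lemma is_ncpartP p P :
  is_ncpart p P <->
  [/\ forall U x, U \in P -> x \in U -> (x < p)%N,
      forall x, (x < p)%N -> exists2 U, U \in P & x \in U,
      forall U V x, U \in P -> V \in P -> x \in U -> x \in V -> U = V,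
      forall U, U \in P -> exists x, x \in U
    & noncrossing P].
Proof.
split.
  case/and4P => /eqP cP /trivIfsetP tP nP /asboolP ncP.
  have mem x : (x \in fcover P) = (x < p)%N by rewrite cP !inE /= mem_iota.
  split=> //.
  - move=> U x UP xU; rewrite -mem; apply/bigfcupP.
    by exists U => //; rewrite UP.
  - move=> x; rewrite -mem => /bigfcupP [U]; rewrite andbT => UP xU.
    by exists U.
  - move=> U V x UP VP xU xV; apply/eqP; apply/negPn/negP => /(tP _ _ UP VP).
    by move/fdisjointP => /(_ _ xU); rewrite xV.
  - move=> U UP; apply/fset0Pn; apply: contraNneq nP => <-; exact: UP.
case=> lt ex inj ne ncP; apply/and4P; split; last exact/asboolP.
- apply/eqP/fsetP => x; rewrite !inE /= mem_iota add0n /=.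
  apply/bigfcupP/idP => [[U]|/ex [U UP xU]]; last by exists U; rewrite ?UP.
  by rewrite andbT => /lt; apply.
- apply/trivIfsetP => U V UP VP UV; apply/fdisjointP => x xU.
  by apply: contraNN UV => xV; apply/eqP; apply: inj xU xV.
- by apply/negP => /ne [x]; rewrite inE.
Qed.

Record ncpart := NCPart {
  ncdata : nat * {fset {fset nat}};
  ncdataP : is_ncpart ncdata.1 ncdata.2 }.

HB.instance Definition _ := [isSub for ncdata].
HB.instance Definition _ := [Choice of ncpart by <:].

Definition ncsize (p : ncpart) : nat := (ncdata p).1.
Definition blocks (p : ncpart) : {fset {fset nat}} := (ncdata p).2.
Definition arity (p : ncpart) : nat := (ncsize p).+1.

Lemma is_ncpart0 : is_ncpart 0 fset0.
Proof. by apply/is_ncpartP; split=> // [U x|U V x|U|U V a b c d]; rewrite inE. Qed.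

Definition ncempty : ncpart := @NCPart (0%N, fset0) is_ncpart0.

Definition relabel (f : nat -> nat) (P : {fset {fset nat}}) : {fset {fset nat}} :=
  [fset [fset f x | x in V]%fset | V : {fset nat} in P]%fset.

(* The gap j of p (0 <= j <= ncsize p) lies just before the element j, the last
   one being after all elements, and receives the j-th partition of q. After
   insertion, the element x of p is preceded by x elements of p and by the
   partitions inserted in the gaps 0, ..., x, and the element y of the j-th
   partition by j elements of p, the partitions inserted in the gaps before j,
   and y elements of its own partition. Only size q = arity p is meaningful:
   otherwise q is truncated or padded with empty partitions. *)
Section Insertion.
Variables (p : ncpart) (q : seq ncpart).

Definition nthgap (j : nat) : ncpart := nth ncempty q j.
Definition offset (j : nat) : nat := \sum_(0 <= i < j) ncsize (nthgap i).
Definition outer_pos (x : nat) : nat := (x + offset x.+1)%N.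
Definition inner_pos (j y : nat) : nat := (j + offset j + y)%N.
Definition ins_size : nat := (ncsize p + offset (arity p))%N.
Definition ins_blocks : {fset {fset nat}} :=
  (relabel outer_pos (blocks p) `|`
   \bigcup_(j <- iota 0 (arity p)) relabel (inner_pos j) (blocks (nthgap j)))%fset.

Lemma offsetS j : offset j.+1 = (offset j + ncsize (nthgap j))%N.
Proof. by rewrite /offset big_nat_recr. Qed.

Lemma offset_mono i j : (i <= j)%N -> (offset i <= offset j)%N.
Proof.
elim: j => [|j IH]; first by rewrite leqn0 => /eqP ->.
rewrite leq_eqVlt => /predU1P [->//|]; rewrite ltnS => /IH le.
by rewrite offsetS (leq_trans le) ?leq_addr.
Qed.

Lemma inner_outer j y x : (y < ncsize (nthgap j))%N -> (j <= x)%N ->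
  (inner_pos j y < outer_pos x)%N.
Proof.
move=> ly le; have := @offset_mono j.+1 x.+1 le.
by rewrite offsetS /inner_pos /outer_pos; lia.
Qed.

Lemma outer_inner j y x : (x < j)%N -> (outer_pos x < inner_pos j y)%N.
Proof. by move=> lt; have := offset_mono lt; rewrite /inner_pos /outer_pos; lia. Qed.

Lemma outer_mono x x' : (x < x')%N -> (outer_pos x < outer_pos x')%N.
Proof.
move=> lt; have := @offset_mono x.+1 x'.+1 (ltnW lt).
by rewrite /outer_pos; lia.
Qed.

Lemma outer_lt x x' : (outer_pos x < outer_pos x')%N -> (x < x')%N.
Proof.
move=> lt; rewrite ltnNge leq_eqVlt; apply/negP => /predU1P [E|/outer_mono].
  by move: lt; rewrite E ltnn.
by move=> lt'; have := ltn_trans lt lt'; rewrite ltnn.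
Qed.

Lemma outer_inj : injective outer_pos.
Proof.
move=> x x' E; case: (ltngtP x x') => // /outer_mono; by rewrite E ltnn.
Qed.

Lemma inner_mono j y j' y' : (y < ncsize (nthgap j))%N -> (j < j')%N ->
  (inner_pos j y < inner_pos j' y')%N.
Proof.
by move=> ly lt; apply: ltn_trans (inner_outer ly (leqnn j)) (outer_inner _ lt).
Qed.

Lemma pos_cover m z : (z < m + offset m.+1)%N ->
  (exists2 x, (x < m)%N & z = outer_pos x) \/
  (exists j, exists2 y, (j <= m)%N /\ (y < ncsize (nthgap j))%N & z = inner_pos j y).
Proof.
elim: m => [|m IH]; rewrite offsetS.
  rewrite add0n /offset big_geq // add0n => lz; right; exists 0%N, z => //.
  by rewrite /inner_pos /offset big_geq.
move=> lz; case: (ltngtP z (m + offset m.+1)) => [/IH|gt|->].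
- case=> [[x lx ->]|[j [y [lj ly] ->]]]; [left|right].
    by exists x => //; rewrite ltnS ltnW.
  by exists j, y => //; split=> //; apply: leqW.
- right; exists m.+1, (z - (m.+1 + offset m.+1))%N; rewrite /inner_pos; last by lia.
  by split=> //; lia.
- by left; exists m.
Qed.

Lemma ins_blocksP U :
  U \in ins_blocks <->
  (exists2 V, V \in blocks p & U = [fset outer_pos x | x in V]%fset) \/
  (exists j, exists2 V, (j <= ncsize p)%N /\ V \in blocks (nthgap j) &
     U = [fset inner_pos j y | y in V]%fset).
Proof.
rewrite /ins_blocks in_fsetU; split.
  case/orP => [/imfsetP [V /= VP ->]|]; first by left; exists V.
  case/bigfcupP => j; rewrite andbT mem_iota add0n ltnS => lj.
  by case/imfsetP => V /= VP ->; right; exists j, V.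
case=> [[V VP ->]|[j [V [lj VP] ->]]]; apply/orP; [left|right].
  by apply/imfsetP; exists V.
apply/bigfcupP; exists j; first by rewrite andbT mem_iota add0n ltnS.
by apply/imfsetP; exists V.
Qed.

Lemma insP : is_ncpart ins_size ins_blocks.
Proof.
have /is_ncpartP [plt pex pinj pne pnc] := ncdataP p.
have gP j := (is_ncpartP _ _).1 (ncdataP (nthgap j)).
apply/is_ncpartP; split.
- move=> U z /ins_blocksP [[V VP ->]|[j [V [lj VP] ->]]] /imfsetP [x /= xV ->].
    have lx := plt _ _ VP xV; have := @offset_mono x.+1 (arity p).
    by rewrite /outer_pos /ins_size /arity /ncsize; lia.
  have [glt _ _ _ _] := gP j; have lx := glt _ _ VP xV.
  have := @offset_mono j.+1 (arity p).
  by rewrite offsetS /inner_pos /ins_size /arity /ncsize; move: lj; rewrite /ncsize; lia.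
- move=> z /pos_cover [[x lx ->]|[j [y [lj ly] ->]]].
    have [V VP xV] := pex _ lx; exists [fset outer_pos x | x in V]%fset.
      by apply/ins_blocksP; left; exists V.
    by apply/imfsetP; exists x.
  have [_ gex _ _ _] := gP j; have [V VP yV] := gex _ ly.
  exists [fset inner_pos j y | y in V]%fset; last by apply/imfsetP; exists y.
  by apply/ins_blocksP; right; exists j, V.
- move=> U U' z /ins_blocksP [[V VP ->]|[j [V [lj VP] ->]]] /ins_blocksP
    [[V' VP' ->]|[j' [V' [lj' VP'] ->]]] /imfsetP [x /= xV ->] /imfsetP [x' /= xV'].
  + by move/outer_inj => E; subst x'; rewrite (pinj V V' x).
  + have [glt _ _ _ _] := gP j'; have lx := glt _ _ VP' xV' => E.
    case: (leqP j' x) => [/(inner_outer lx)|/(outer_inner x')];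
      by rewrite E ltnn.
  + have [glt _ _ _ _] := gP j; have lx := glt _ _ VP xV => E.
    case: (leqP j x') => [/(inner_outer lx)|/(outer_inner x)];
      by rewrite E ltnn.
  + have [glt _ _ _ _] := gP j; have lx := glt _ _ VP xV => E.
    have [glt' _ _ _ _] := gP j'; have lx' := glt' _ _ VP' xV'.
    case: (ltngtP j j') => [/(inner_mono x' lx)|/(inner_mono x lx')|jj'];
      [by rewrite E ltnn|by rewrite E ltnn|subst j'].
    have {E} E : x = x' by move: E; rewrite /inner_pos; lia.
    by subst x'; have [_ _ ginj _ _] := gP j; rewrite (ginj V V' x).
- move=> U /ins_blocksP [[V VP ->]|[j [V [lj VP] ->]]].
    by have [x xV] := pne _ VP; exists (outer_pos x); apply/imfsetP; exists x.
  have [_ _ _ gne _] := gP j; have [x xV] := gne _ VP.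
  by exists (inner_pos j x); apply/imfsetP; exists x.
- move=> U U' a b c d /ins_blocksP [[V VP ->]|[j [V [lj VP] ->]]] /ins_blocksP
    [[V' VP' ->]|[j' [V' [lj' VP'] ->]]] /imfsetP [a' /= aV ->]
    /imfsetP [b' /= bV ->] /imfsetP [c' /= cV ->] /imfsetP [d' /= dV ->].
  + move=> /outer_lt ab /outer_lt bc /outer_lt cd.
    by rewrite (pnc V V' a' b' c' d').
  + have [glt _ _ _ _] := gP j'; have lb := glt _ _ VP' bV; have ld := glt _ _ VP' dV.
    move=> _ bc cd; case: (leqP j' c') => [/(inner_outer ld)|/(outer_inner b')];
      by [move/(ltn_trans cd); rewrite ltnn|move/(ltn_trans bc); rewrite ltnn].
  + have [glt _ _ _ _] := gP j; have la := glt _ _ VP aV; have lc := glt _ _ VP cV.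
    move=> ab bc _; case: (leqP j b') => [/(inner_outer lc)|/(outer_inner a')];
      by [move/(ltn_trans bc); rewrite ltnn|move/(ltn_trans ab); rewrite ltnn].
  + have [glt _ _ _ gnc] := gP j; have lc := glt _ _ VP cV.
    have [glt' _ _ _ _] := gP j'; have lb := glt' _ _ VP' bV.
    move=> ab bc cd.
    case: (ltngtP j j') => [/(inner_mono b' lc)|/(inner_mono a' lb)|jj'].
    * by move/(ltn_trans bc); rewrite ltnn.
    * by move/(ltn_trans ab); rewrite ltnn.
    * subst j'; congr (imfset _ _ _).
      have -> // : V = V'.
      by apply: (gnc V V' a' b' c' d') => //; rewrite /inner_pos in ab bc cd; lia.
Qed.

Definition gap_ins : ncpart := @NCPart (ins_size, ins_blocks) insP.
End Insertion.

Lemma arity_gap_ins (p : ncpart) (q : seq ncpart) :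
  size q = arity p -> arity (gap_ins p q) = inputs arity q.
Proof.
move=> sq; rewrite /inputs sumnE big_map.
rewrite (eq_bigr (fun a => 1 + ncsize a)%N); last by [].
rewrite big_split /= sum1_size sq /arity /ncsize /= /ins_size addSn.
congr (_ + _).+1; rewrite /offset -sq (big_nth ncempty).
by apply: eq_bigr.
Qed.

(* The second word is cut into consecutive groups of sizes the arities of the
   letters of the first. *)
Definition nabla_word (u v : seq ncpart) : seq ncpart :=
  [seq gap_ins x.1 x.2 | x <- zip u (reshape (map arity u) v)].

Lemma size_nabla_word u v : size (nabla_word u v) = size u.
Proof. by rewrite size_map size_zip size_reshape size_map minnn. Qed.

Lemma inputs_nabla_word u v : size v = inputs arity u ->
  inputs arity (nabla_word u v) = inputs arity v.
Proof.
elim: u v => [|p u IH] v; first by move/size0nil ->.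
rewrite {1}/inputs /= => sv; rewrite -{2}(cat_take_drop (arity p) v).
have st : size (take (arity p) v) = arity p by rewrite size_takel // sv leq_addr.
rewrite /nabla_word /= /inputs /= map_cat sumn_cat -!/(inputs _ _).
rewrite arity_gap_ins // -/(nabla_word _ _) IH // size_drop sv.
by rewrite addKn.
Qed.

Definition ncword := word arity.

Lemma wnabla_m n k m (u : ncword n k) (v : ncword k m) :
  inputs arity (nabla_word (val u) (val v)) = m.
Proof. by rewrite inputs_nabla_word ?word_n ?word_m. Qed.

Definition wnabla n k m (u : ncword n k) (v : ncword k m) : ncword n m :=
  mkword (etrans (size_nabla_word _ _) (word_n u)) (wnabla_m u v).

Lemma inputs_nseq n : inputs arity (nseq n ncempty) = n.
Proof. by rewrite /inputs map_nseq sumn_nseq mul1n. Qed.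

Definition factors (p : ncpart) : set {a : ncpart & ncword (arity a) (arity p)} :=
  [set x : {a : ncpart & ncword (arity a) (arity p)} |
     wnabla (letter arity (tag x)) (tagged x) = letter arity p]%classic.
Arguments factors : clear implicits.

Definition is_interval (p : ncpart) : Prop :=
  forall (V : {fset nat}) (a b c : nat), V \in blocks p -> a \in V -> c \in V ->
    (a < b)%N -> (b < c)%N -> b \in V.

Lemma ncsize_gap_ins p q : (ncsize p <= ncsize (gap_ins p q))%N.
Proof. exact: leq_addr. Qed.

Lemma inputs_ge q p : p \in q -> (arity p <= inputs arity q)%N.
Proof.
elim: q => // a q IH; rewrite inE /inputs /= => /predU1P [->|/IH le].
  exact: leq_addr.
by rewrite (leq_trans le) ?leq_addl.
Qed.

Lemma finite_ncsize N : finite_set [set p : ncpart | (ncsize p <= N)%N]%classic.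
Proof.
pose X : {fset nat} := [fset x in iota 0 N.+1]%fset.
pose D := (X `*` fpowerset (fpowerset X))%fset.
apply: (@sub_finite_set _ _ (ncdata @^-1` [set` D])%classic); last first.
  apply: finite_preimage; last exact: finite_fset.
  by move=> x y _ _; apply: val_inj.
move=> p /= le; rewrite in_fsetM; apply/andP; split.
  by rewrite /X in_fset mem_iota.
have /is_ncpartP [lt _ _ _ _] := ncdataP p.
rewrite fpowersetE; apply/fsubsetP => U UP; rewrite fpowersetE; apply/fsubsetP => x xU.
rewrite /X in_fset mem_iota add0n /= ltnS; apply: leq_trans le; apply: ltnW.
exact: lt UP xU.
Qed.

Lemma finite_bounded_seq (T : choiceType) (A : set T) N : finite_set A ->
  finite_set [set s : seq T | (size s <= N)%N /\ forall x, x \in s -> A x]%classic.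
Proof.
move=> fA; elim: N => [|N IH].
  apply: (@sub_finite_set _ _ [set [::]]%classic); last exact: finite_set1.
  by move=> s [/=]; rewrite leqn0 => /nilP.
apply: (@sub_finite_set _ _ ([set [::]] `|`
  [set x :: s | x in A & s in
     [set s : seq T | (size s <= N)%N /\ forall x, x \in s -> A x]])%classic).
  move=> [|x s] [/= ls As]; [by left|right].
  exists x; first by apply: As; rewrite mem_head.
  exists s => //; split=> // y ys; apply: As; by rewrite inE ys orbT.
by rewrite finite_setU; split; [apply: finite_set1|apply: finite_image2].
Qed.

Lemma finite_factors p : finite_set (factors p).
Proof.
pose N := arity p.
pose A := ([set a : ncpart | (ncsize a <= N)%N])%classic.
pose W := ([set s : seq ncpart | (size s <= N)%N /\ forall x, x \in s -> A x])%classic.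
pose g (x : {a : ncpart & ncword (arity a) (arity p)}) := (tag x, val (tagged x)).
apply: (@sub_finite_set _ _ (g @^-1` (A `*` W))%classic); last first.
  apply: finite_preimage; last first.
    apply: finite_setX; first exact: finite_ncsize.
    by apply: finite_bounded_seq; apply: finite_ncsize.
  move=> [a u] [b v] _ _ [/= E1 E2]; subst b; congr existT.
  exact: val_inj.
move=> [a w] /= /(congr1 val) /=; rewrite /nabla_word /= => -[].
rewrite take_oversize ?word_n // => E.
have le : (ncsize a <= ncsize p)%N by rewrite -E; apply: ncsize_gap_ins.
split; rewrite /= /A /W /=; first exact: leq_trans le (leqnSn _).
split; first by rewrite word_n.
by move=> x /inputs_ge; rewrite word_m; apply: ltnW.
Qed.

Section NCHopf.
Variable K : fieldType.

Definition nc_halg : halg K := words_halg K arity.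

Program Definition nc_nabla_bilin n m :
    bilin (fun k => nc_halg n k) (fun k => nc_halg k m) (nc_halg n m) :=
  Bilin (bfun := fun k => lin_ext2 (fun u v => << wnabla u v >>)) _ _.
Next Obligation. by move=> n m k w; apply: lin_ext2l. Qed.
Next Obligation. by move=> n m k v; apply: lin_ext2r. Qed.

Definition nc_nabla : hom (vtens nc_halg nc_halg) nc_halg :=
  fun n m => dlift (nc_nabla_bilin n m).

Definition nc_eta : hom (vunit K) nc_halg :=
  vunit_map (fun n => << mkword (size_nseq n ncempty) (inputs_nseq n) >>).

(* The sum is over a finite set (finite_factors); otherwise \sum_(_ \in _)
   would have been 0 by convention. *)
Definition nc_Delta : hom nc_halg (vtens nc_halg nc_halg) :=
  words_ext (A := vprod_halg nc_halg nc_halg) (fun p =>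
    \sum_(x \in factors p)
       vpure (P := nc_halg) (Q := nc_halg) << letter arity (tag x) >> << tagged x >>).

Definition nc_eps : hom nc_halg (vunit K) :=
  words_ext (A := vunit_halg K) (fun p =>
    if p == ncempty then const_mx 1 else 0).

Definition nc_S : hom nc_halg nc_halg :=
  words_ext (A := nc_halg) (fun p =>
    if `[< is_interval p >]
    then (-1) ^+ #|` blocks p| *: << letter arity p >> else 0).
End NCHopf.

(* Main.v *)
From Pilot Require Import Defs.
From mathcomp Require Import all_boot all_algebra.
From mathcomp Require Import reals complex.
From mathcomp Require Import finmap boolp classical_sets fsbigop cardinality.
From mathcomp Require Import monalg zify.

Import Pilot.Defs.
Set Implicit Arguments.
Unset Strict Implicit.
Unset Printing Implicit Defensive.
Import GRing.Theory.

(** All the structure maps are explicit in the basis of words, so that every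
   axiom is an identity between finite sums over factorizations.

   Non-crossing partitions are handled through their opening-closing words
   ([code]), which record at each position whether it opens and whether it closes
   its block. Such a word determines the partition ([code_inj]), and gap insertion
   becomes the interleaving of words ([code_gap_ins]). The associativity and the
   unit laws of gap insertion, hence those of the vertical product, are then
   statements about lists ([gap_ins_assoc], [nabla_assoc]). Dually the coproduct
   of a word [w] is the sum of [u (x) v] over the pairs with
   [nabla_word u v = w] ([nc_DeltaE]); a factorization of a concatenation is a
   pair of factorizations, so the coproduct is a horizontal morphism, and both
   sides of coassociativity sum over the factorizations of [w] into three words
   ([sum_word_fact_assoc]).

   The antipode multiplies a word by a sign, or kills it. Therefore [id * S] sends
   a word [w] to [w] times the sum of the signs of [v] over its factorizations
   [(u, v)]. This sum is multiplicative in [w], and for a letter other than the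
   empty partition it is zero ([sum_word_sign]): all letters of [v] being interval
   partitions, the block which closes first, necessarily an interval, can be moved
   between [u] and [v], and this changes the sign.

   The other antipode identity follows formally ([conv_left_antipode]). Convolution
   is associative, so [id * (S * id - eta eps) = 0]; as the identity is [eta eps]
   plus a map supported in bidegrees [(n, k)] with [n < k], this forces
   [S * id = eta eps] by induction on the difference between the numbers of inputs
   and of outputs.

   Co-nilpotency holds because every letter has at least one input: a word has at
   least as many inputs as letters, with equality only for words of empty
   partitions, and the reduced coproduct strictly lowers the number of inputs of
   the left factor. *)

(** * Interleaving of sequences *)

Section Interleave.
Variable T : Type.
Implicit Types (c : seq T) (d e : seq (seq T)).

(** [interleave c d] inserts the sequence [nth [::] d i] just before the [i]-th
   entry of [c], and [nth [::] d (size c)] at the end. *)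
Fixpoint interleave c d : seq T :=
  head [::] d ++ if c is x :: c' then x :: interleave c' (behead d) else [::].

Lemma interleave_nil_l c1 c2 d :
  interleave (c1 ++ c2) (nseq (size c1) [::] ++ d) = c1 ++ interleave c2 d.
Proof. by elim: c1 => //= x c1 ->. Qed.

Lemma interleave_nils c : interleave c (nseq (size c).+1 [::]) = c.
Proof.
have -> : nseq (size c).+1 [::] = nseq (size c) [::] ++ [:: [::]] :> seq (seq T).
  by rewrite -addn1 nseqD.
by rewrite -{1}[c]cats0 interleave_nil_l /= cats0.
Qed.

Lemma interleave_cat_hd c d (a e : seq T) :
  interleave c ((a ++ e) :: d) = a ++ interleave c (e :: d).
Proof. by case: c => [|x c] /=; rewrite catA. Qed.

Lemma interleave_cat (b : seq T) x t e :
  interleave (b ++ x :: t) e =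
  interleave b (take (size b).+1 e) ++ x :: interleave t (drop (size b).+1 e).
Proof.
elim: b e => [|y b IH] [|d e] //=; rewrite ?take0 ?drop0 ?cats0 //.
  by rewrite (IH [::]).
by rewrite IH -catA.
Qed.

Lemma interleave_take c e : interleave c (take (size c).+1 e) = interleave c e.
Proof. by elim: c e => [|x c IH] [|d e] //=; rewrite IH. Qed.

Lemma interleave_assoc c d e : size d = (size c).+1 ->
  interleave (interleave c d) e =
  interleave c [seq interleave x.1 x.2 |
                  x <- zip d (reshape [seq (size b).+1 | b <- d] e)].
Proof.
elim: c d e => [|x c IH] [|b d] //= e => [_|[sd]].
  by rewrite /= !cats0 interleave_take.
by rewrite interleave_cat IH.
Qed.
End Interleave.

(** * The opening-closing word of a non-crossing partition *)

Lemma blocks_lt (p : ncpart) U x : U \in blocks p -> x \in U -> x < ncsize p.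
Proof. by have /is_ncpartP [H _ _ _ _] := ncdataP p; apply: H. Qed.
Lemma blocks_ex (p : ncpart) x : x < ncsize p -> exists2 U, U \in blocks p & x \in U.
Proof. by have /is_ncpartP [_ H _ _ _] := ncdataP p; apply: H. Qed.
Lemma blocks_inj (p : ncpart) U V x :
  U \in blocks p -> V \in blocks p -> x \in U -> x \in V -> U = V.
Proof. by have /is_ncpartP [_ _ H _ _] := ncdataP p; apply: H. Qed.
Lemma blocks_ne (p : ncpart) U : U \in blocks p -> exists x, x \in U.
Proof. by have /is_ncpartP [_ _ _ H _] := ncdataP p; apply: H. Qed.
Lemma blocks_nc (p : ncpart) : noncrossing (blocks p).
Proof. by have /is_ncpartP [_ _ _ _ H] := ncdataP p. Qed.

(** The order on positions, reversed when [b] is [false]. *)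
Definition lebool (b : bool) (x y : nat) : bool := if b then x <= y else y <= x.

(** [extremal true p x] (resp. [extremal false p x]): the position [x] is the
   first (resp. the last) element of a block of [p]. *)
Definition extremal (b : bool) (p : ncpart) (x : nat) : bool :=
  `[< exists2 V, V \in blocks p & x \in V /\ forall y, y \in V -> lebool b x y >].

(** The word recording, for each position, whether it opens its block and
   whether it closes its block. *)
Definition code (p : ncpart) : seq (bool * bool) :=
  [seq (extremal true p x, extremal false p x) | x <- iota 0 (ncsize p)].

Lemma size_code p : size (code p) = ncsize p.
Proof. by rewrite size_map size_iota. Qed.

Lemma nth_code p x x0 : x < ncsize p ->
  nth x0 (code p) x = (extremal true p x, extremal false p x).
Proof. by move=> lx; rewrite (nth_map 0) ?size_iota // nth_iota. Qed.

Lemma extremalP b p V x : V \in blocks p -> x \in V ->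
  reflect (forall y, y \in V -> lebool b x y) (extremal b p x).
Proof.
move=> VP xV; apply: (iffP (asboolP _)) => [[W WP [xW H]]|H]; last by exists V.
by rewrite (blocks_inj VP WP xV xW).
Qed.

Lemma extremal_lt b p x : extremal b p x -> x < ncsize p.
Proof. by case/asboolP => V VP [xV _]; apply: blocks_lt VP xV. Qed.

Lemma block_pred p V x : V \in blocks p -> x \in V -> ~~ extremal true p x ->
  exists y, [/\ y \in V, y < x & forall z, z \in V -> z < x -> z <= y].
Proof.
move=> VP xV /(extremalP true VP xV) H.
have [y [yV yx]] : exists y, y \in V /\ y < x.
  apply: contrapT => N; apply: H => y yV /=; rewrite leqNgt; apply/negP => yx.
  by apply: N; exists y.
have E : exists y, (y \in V) && (y < x) by exists y; rewrite yV.
have B : forall y, (y \in V) && (y < x) -> y <= x by move=> z /andP [_ /ltnW].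
case: (ex_maxnP E B) => z /andP [zV zx] M; exists z; split=> // t tV tx.
by apply: M; rewrite tV.
Qed.

Lemma block_succ p V x : V \in blocks p -> x \in V -> ~~ extremal false p x ->
  exists2 y, y \in V & x < y.
Proof.
move=> VP xV /(extremalP false VP xV) H.
apply: contrapT => N; apply: H => y yV /=; rewrite leqNgt; apply/negP => yx.
by apply: N; exists y.
Qed.

(** The positions [x] and [y] lie in the same block of [p]. *)
Definition same (p : ncpart) (x y : nat) : Prop :=
  exists2 V, V \in blocks p & x \in V /\ y \in V.

(** If two partitions with the same word agree below [x], the predecessor [y] of
   [x] in its block for the first one is at least its predecessor [y'] for the
   second one. Otherwise [y'], which does not close its block, has in the first
   partition a successor between [y'] and [x], by non-crossingness; the two
   partitions then share this successor, which contradicts the choice of [y']. *)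
Lemma code_pred_le p p' V V' x y y' : code p = code p' ->
  (forall z t, z < x -> t < z -> same p t z -> same p' t z) ->
  V \in blocks p -> x \in V -> y \in V -> y < x ->
  (forall z, z \in V -> z < x -> z <= y) ->
  V' \in blocks p' -> x \in V' -> y' \in V' -> y' < x ->
  (forall z, z \in V' -> z < x -> z <= y') ->
  y' <= y.
Proof.
move=> E IH VP xV yV yx My VP' xV' yV' yx' My'; rewrite leqNgt; apply/negP => lt.
have Es : ncsize p = ncsize p' by rewrite -!size_code E.
have ls : y' < ncsize p' by apply: blocks_lt VP' yV'.
have ncl : ~~ extremal false p y'.
  have : nth (true, true) (code p) y' = nth (true, true) (code p') y' by rewrite E.
  rewrite !nth_code ?Es // => -[_ ->]; apply/negP => /(extremalP _ VP' yV').
  by move/(_ _ xV') => /=; rewrite leqNgt yx'.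
have [W WP yW] : exists2 U, U \in blocks p & y' \in U by apply: blocks_ex; rewrite Es.
have [z zW yz] := block_succ WP yW ncl.
have NV : W <> V by move=> e; subst W; have := My _ yW yx'; lia.
have zx : z < x.
  case: (ltngtP z x) => [//|xz|zx].
    by case: NV; symmetry; apply: (blocks_nc VP WP yV yW xV zW).
  by subst z; case: NV; apply: (blocks_inj WP VP zW xV).
have [W' WP' [yW' zW']] : same p' y' z by apply: IH => //; exists W.
have e := blocks_inj WP' VP' yW' yV'; subst W'.
by have := My' _ zW' zx; lia.
Qed.

Lemma code_same p p' x : code p = code p' ->
  forall y, y < x -> same p y x -> same p' y x.
Proof.
move=> E; suff H : forall y, y < x -> same p y x <-> same p' y x.
  by move=> y /H [].
have Es : ncsize p = ncsize p' by rewrite -!size_code E.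
elim/ltn_ind: x => x IH.
have key q q' : code q = code q' -> (forall z t, z < x -> t < z -> same q t z <-> same q' t z) ->
    forall y, y < x -> same q y x -> same q' y x.
  move=> {p p' E Es IH}E IH y yx [V VP [yV xV]].
  have Es : ncsize q = ncsize q' by rewrite -!size_code E.
  have lx := blocks_lt VP xV.
  have nop : ~~ extremal true q x.
    by apply/negP => /(extremalP _ VP xV) /(_ _ yV) /=; rewrite leqNgt yx.
  have nop' : ~~ extremal true q' x.
    have : nth (true, true) (code q) x = nth (true, true) (code q') x by rewrite E.
    by rewrite !nth_code -?Es // => -[<-].
  have [V' VP' xV'] : exists2 U, U \in blocks q' & x \in U by apply: blocks_ex; rewrite -Es.
  have [z [zV zx Mz]] := block_pred VP xV nop.
  have [z' [zV' zx' Mz']] := block_pred VP' xV' nop'.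
  have e : z = z'.
    apply/eqP; rewrite eqn_leq; apply/andP; split.
      by apply: (code_pred_le (esym E) _ VP' xV' zV' zx' Mz' VP xV zV zx Mz) => s t sx ts /(IH _ _ sx ts).
    by apply: (code_pred_le E _ VP xV zV zx Mz VP' xV' zV' zx' Mz') => s t sx ts /(IH _ _ sx ts).
  subst z'; have := Mz _ yV yx; rewrite leq_eqVlt => /predU1P [->|yz].
    by exists V'.
  have [W WP [yW zW]] : same q' y z by apply/IH => //; exists V.
  by rewrite -(blocks_inj WP VP' zW zV') in xV' *; exists W.
move=> y yx; split; first exact: (key p p' E (fun z t zx => IH z zx t) y yx).
apply: (key p' p (esym E) _ y yx) => z t zx tz.
by have [] := IH _ zx _ tz; split.
Qed.

(** A non-crossing partition is determined by its opening-closing word. *)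
Lemma code_inj : injective code.
Proof.
have sub p p' U : code p = code p' -> U \in blocks p -> U \in blocks p'.
  move=> E UP.
  have Es : ncsize p = ncsize p' by rewrite -!size_code E.
  have [x xU] := blocks_ne UP; have lx := blocks_lt UP xU.
  have [V VP xV] : exists2 V, V \in blocks p' & x \in V by apply: blocks_ex; rewrite -Es.
  suff -> : U = V by [].
  have K q q' W W' t y : code q = code q' -> W \in blocks q -> W' \in blocks q' ->
      t \in W -> t \in W' -> y \in W -> y \in W'.
    move=> E' WP WP' tW tW' yW; case: (ltngtP y t) => [lt|lt|->//].
      have [X XP [yX tX]] : same q' y t by apply: (code_same E') => //; exists W.
      by rewrite (blocks_inj WP' XP tW' tX).
    have [X XP [tX yX]] : same q' t y by apply: (code_same E') => //; exists W.
    by rewrite (blocks_inj WP' XP tW' tX).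
  by apply/fsetP => y; apply/idP/idP; [apply: (K p p' _ _ x) | apply: (K p' p _ _ x)].
move=> p p' E; apply: val_inj.
have Es : ncsize p = ncsize p' by rewrite -!size_code E.
have Eb : blocks p = blocks p' by apply/fsetP => U; apply/idP/idP; apply: sub.
by move: Es Eb; rewrite /ncsize /blocks /=; case: (ncdata p) (ncdata p') => [? ?] [? ?] /= -> ->.
Qed.

(** Gap insertion interleaves opening-closing words. *)
Section CodeInsertion.
Variables (p : ncpart) (q : seq ncpart).
Let G := gap_ins p q.

Lemma extremal_outer b x : extremal b G (outer_pos q x) = extremal b p x.
Proof.
have mono y : lebool b (outer_pos q x) (outer_pos q y) = lebool b x y.
  have M y' z : (outer_pos q y' <= outer_pos q z) = (y' <= z).
    by apply: leq_mono => s t; apply: outer_mono.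
  by case: b; apply: M.
apply/asboolP/asboolP => [[U /ins_blocksP [[V VP ->]|[j [V [lj VP] ->]]] [xU H]]|[V VP [xV H]]].
- exists V => //; split.
    by case/imfsetP: xU => y /= yV /outer_inj ->.
  by move=> y yV; rewrite -mono; apply: H; apply/imfsetP; exists y.
- case/imfsetP: xU => y /= /(blocks_lt VP) ly e.
  by case: (leqP j x) => [/(inner_outer ly)|/(outer_inner q y)]; rewrite e ltnn.
- exists [fset outer_pos q x | x in V]%fset; first by apply/ins_blocksP; left; exists V.
  split; first by apply/imfsetP; exists x.
  by move=> z /imfsetP [y /= yV ->]; rewrite mono; apply: H.
Qed.

Lemma extremal_inner b j y : j <= ncsize p -> y < ncsize (nthgap q j) ->
  extremal b G (inner_pos q j y) = extremal b (nthgap q j) y.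
Proof.
move=> lj ly.
have mono z : lebool b (inner_pos q j y) (inner_pos q j z) = lebool b y z.
  by case: b; rewrite /= leq_add2l.
apply/asboolP/asboolP => [[U /ins_blocksP [[V VP ->]|[j' [V [lj' VP] ->]]] [xU H]]|[V VP [xV H]]].
- case/imfsetP: xU => x /= _ e.
  by case: (leqP j x) => [/(inner_outer ly)|/(outer_inner q y)]; rewrite e ltnn.
- have [y' yV' e] : exists2 y', y' \in V & inner_pos q j y = inner_pos q j' y'.
    by case/imfsetP: xU => y' /= yV' e; exists y'.
  have ly' := blocks_lt VP yV'.
  have ej : j = j'.
    case: (ltngtP j j') => // [/(inner_mono y' ly)|/(inner_mono y ly')]; by rewrite e ltnn.
  subst j'; have ey : y = y' by move: e; rewrite /inner_pos; lia.
  subst y'; exists V => //; split=> // z zV; rewrite -mono; apply: H.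
  by apply/imfsetP; exists z.
- exists [fset inner_pos q j y | y in V]%fset.
    by apply/ins_blocksP; right; exists j, V.
  split; first by apply/imfsetP; exists y.
  by move=> z /imfsetP [x /= xxV ->]; rewrite mono; apply: H.
Qed.

Lemma code_gap_ins : code G = interleave (code p) (map code q).
Proof.
pose n := ncsize p.
pose f z := (extremal true G z, extremal false G z).
have fo x : f (outer_pos q x) = (extremal true p x, extremal false p x).
  by rewrite /f !extremal_outer.
have fi j : j <= n -> [seq f z | z <- iota (j + offset q j) (ncsize (nthgap q j))] =
    code (nthgap q j).
  move=> lj; rewrite /code -[_ + _]addn0 iotaDl -map_comp; apply/eq_in_map => y.
  by rewrite mem_iota add0n /= => ly; rewrite /f !extremal_inner.
have hd j : head [::] (drop j (map code q)) = code (nthgap q j).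
  by rewrite /nthgap -nth0 nth_drop addn0; case: (ltnP j (size q)) => lj;
    [rewrite (nth_map ncempty)|rewrite !nth_default ?size_map].
suff H k i : i + k = n ->
    [seq f z | z <- iota (i + offset q i) (ins_size p q - (i + offset q i))] =
    interleave (drop i (code p)) (drop i (map code q)).
  have := H n 0 erefl; rewrite !drop0 => <-.
  by rewrite /offset big_geq // addn0 subn0.
elim: k i => [|k IH] i e.
  rewrite addn0 in e; subst i; rewrite drop_oversize ?size_code //= cats0 hd -fi //.
  congr map; congr iota; rewrite /ins_size /arity offsetS -/n; lia.
have li : i < n by lia.
rewrite (drop_nth (false, false)) ?size_code //= hd -fi 1?ltnW // -drop1 drop_drop add1n.
rewrite -IH; last by lia.
rewrite nth_code // -fo -[_ :: _]/(map f (_ :: _)) -map_cat; congr map.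
have lo := @offset_mono q i.+2 (arity p); move: lo; rewrite !offsetS => lo.
have -> : ins_size p q - (i + offset q i) = ncsize (nthgap q i) +
   (1 + (ins_size p q - (i.+1 + offset q i.+1))).
  have : offset q i.+1 <= offset q (arity p) by apply: offset_mono; rewrite /arity -/n; lia.
  by rewrite /ins_size offsetS -/n; lia.
rewrite iotaD; congr cat; rewrite iotaD /= /outer_pos offsetS; congr cons.
  by lia.
by congr iota; lia.
Qed.
End CodeInsertion.

(** * Operadic laws of gap insertion *)

Lemma code_nil p : code p = [::] -> p = ncempty.
Proof. by move=> e; apply: code_inj. Qed.

Lemma map_code_nseq n : map code (nseq n ncempty) = nseq n [::].
Proof. by rewrite map_nseq. Qed.

Lemma gap_ins_ncempty p : gap_ins ncempty [:: p] = p.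
Proof. by apply: code_inj; rewrite code_gap_ins /= cats0. Qed.

Lemma gap_ins_nseq p : gap_ins p (nseq (arity p) ncempty) = p.
Proof.
by apply: code_inj; rewrite code_gap_ins map_code_nseq /arity -size_code interleave_nils.
Qed.

Lemma gap_ins_assoc p q r : size q = arity p ->
  gap_ins (gap_ins p q) r = gap_ins p (nabla_word q r).
Proof.
move=> sq; apply: code_inj; rewrite !code_gap_ins interleave_assoc; last first.
  by rewrite size_map sq size_code.
congr interleave; rewrite /nabla_word.
rewrite -(map_comp (fun b : seq _ => (size b).+1)).
rewrite (eq_map (_ : _ =1 arity)) => [|x /=]; last by rewrite size_code.
elim: q r {sq} => //= b q IH r.
by rewrite code_gap_ins map_take -IH map_drop.
Qed.

Lemma nabla_cons a u v :
  nabla_word (a :: u) v = gap_ins a (take (arity a) v) :: nabla_word u (drop (arity a) v).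
Proof. by []. Qed.

Lemma inputs_cat (B : choiceType) (ar : B -> nat) u v :
  inputs ar (u ++ v) = inputs ar u + inputs ar v.
Proof. by rewrite /inputs map_cat sumn_cat. Qed.

Lemma inputs_cons a u : inputs arity (a :: u) = arity a + inputs arity u.
Proof. by []. Qed.

Lemma size_inputs u : size u <= inputs arity u.
Proof. by elim: u => // a u IH; rewrite inputs_cons; apply: (leq_add (m1 := 1)). Qed.

Lemma nabla_cat u1 u2 v1 v2 : size v1 = inputs arity u1 ->
  nabla_word (u1 ++ u2) (v1 ++ v2) = nabla_word u1 v1 ++ nabla_word u2 v2.
Proof.
elim: u1 v1 => [|a u1 IH] v1; first by move=> /size0nil ->.
rewrite inputs_cons cat_cons !nabla_cons => sv.
have -> : drop (arity a) (v1 ++ v2) = drop (arity a) v1 ++ v2.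
  rewrite drop_cat; case: ltnP => // le.
  have e : arity a - size v1 = 0 by rewrite sv; lia.
  by rewrite e drop0 drop_oversize.
rewrite take_cat; case: ltnP => lt.
  by rewrite IH ?size_drop ?sv ?addKn.
have e : arity a - size v1 = 0 by rewrite sv; lia.
by rewrite e take0 cats0 take_oversize // IH ?size_drop ?sv ?addKn.
Qed.

Lemma nabla_assoc u v w : size v = inputs arity u -> size w = inputs arity v ->
  nabla_word (nabla_word u v) w = nabla_word u (nabla_word v w).
Proof.
elim: u v w => // a u IH v w; rewrite inputs_cons !nabla_cons => sv.
pose v1 := take (arity a) v; pose v2 := drop (arity a) v.
have s1 : size v1 = arity a by rewrite size_takel // sv leq_addr.
have s2 : size v2 = inputs arity u by rewrite size_drop sv addKn.
have -> : inputs arity v = inputs arity v1 + inputs arity v2.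
  by rewrite -inputs_cat cat_take_drop.
move=> sw.
have t1 : size (take (inputs arity v1) w) = inputs arity v1.
  by rewrite size_takel // sw leq_addr.
rewrite -/v1 -/v2 /= gap_ins_assoc // (arity_gap_ins s1) IH //; last by rewrite size_drop sw addKn.
have -> : nabla_word v w = nabla_word v1 (take (inputs arity v1) w) ++
    nabla_word v2 (drop (inputs arity v1) w).
  by rewrite -nabla_cat // !cat_take_drop.
by rewrite !take_size_cat ?drop_size_cat ?size_nabla_word.
Qed.

Lemma nabla_nseq n v : size v = n -> nabla_word (nseq n ncempty) v = v.
Proof.
elim: n v => [|n IH] [|p v] //= [sv].
by rewrite nabla_cons /= take0 drop0 gap_ins_ncempty IH.
Qed.

Lemma nabla_word_nseq u : nabla_word u (nseq (inputs arity u) ncempty) = u.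
Proof.
elim: u => // p u IH; rewrite inputs_cons nabla_cons nseqD.
by rewrite take_size_cat ?drop_size_cat ?size_nseq // gap_ins_nseq IH.
Qed.

(** * Interval partitions *)

(** In the opening-closing word of an interval partition, a position closes its
   block exactly when the next one opens its block. *)
Definition adjacent (x y : bool * bool) : bool := x.2 == y.1.

Lemma is_intervalE p : `[< is_interval p >] = sorted adjacent (code p).
Proof.
apply/asboolP/(sortedP (false, false)) => [I i|S V a b c VP aV cV ab bc].
  rewrite size_code => li; have li' := ltnW li.
  rewrite /adjacent !nth_code //=.
  have [V VP iV] := blocks_ex li'; have [W WP iW] := blocks_ex li.
  case: (pselect (V = W)) => [e|N].
    subst W; apply/eqP; apply/idP/idP.
      by move/(extremalP _ VP iV)/(_ _ iW); rewrite /= ltnn.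
    by move/(extremalP _ VP iW)/(_ _ iV); rewrite /= ltnn.
  have -> : extremal true p i.+1.
    apply/(extremalP _ WP iW) => y yW /=; rewrite leqNgt ltnS; apply/negP => lt.
    have ne : y != i by apply: contra_notN N => /eqP e; apply: (blocks_inj VP WP iV); rewrite -e.
    apply: N; apply: (blocks_inj VP WP iV); apply: (I W y i i.+1) => //; lia.
  rewrite eqb_id; apply/(extremalP _ VP iV) => y yV /=; rewrite leqNgt; apply/negP => lt.
  have ne : y != i.+1 by apply: contra_notN N => /eqP e; apply: (blocks_inj VP WP _ iW); rewrite -e.
  apply: N; apply: (blocks_inj VP WP _ iW); apply: (I V i i.+1 y) => //; lia.
elim: b ab bc => // b IH ab bc.
have bV : b \in V.
  move: ab; rewrite ltnS leq_eqVlt => /predU1P [<- //|ab]; apply: IH => //; exact: ltnW.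
have lc := blocks_lt VP cV.
have := S b; rewrite size_code => /(_ (ltn_trans bc lc)).
rewrite /adjacent !nth_code /=; [|lia|lia].
have -> : extremal false p b = false.
  by apply/negP => /(extremalP _ VP bV)/(_ _ cV) /=; lia.
rewrite eq_sym eqbF_neg => No.
have [W WP bW] := blocks_ex (ltn_trans bc lc).
have [y [yW yb _]] := block_pred WP bW No.
have [<-//|ne] := eqVneq W V.
move: yb; rewrite ltnS leq_eqVlt => /predU1P [e|yb].
  by rewrite (blocks_inj VP WP bV) // -e.
by rewrite -(blocks_nc WP VP yW bV bW cV yb).
Qed.

Lemma is_ncpart_block k : is_ncpart k.+1 [fset [fset x in iota 0 k.+1]]%fset.
Proof.
apply/is_ncpartP; split.
- by move=> U x /fset1P ->; rewrite in_fset mem_iota.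
- move=> x lx; exists [fset x in iota 0 k.+1]%fset; first exact/fset1P.
  by rewrite in_fset mem_iota.
- by move=> U V x /fset1P -> /fset1P ->.
- by move=> U /fset1P ->; exists 0; rewrite in_fset mem_iota.
- by move=> U V a b c d /fset1P -> /fset1P ->.
Qed.

(** The partition of [k.+1] elements into a single block. *)
Definition block (k : nat) : ncpart :=
  @NCPart (k.+1, [fset [fset x in iota 0 k.+1]]%fset) (is_ncpart_block k).

Lemma code_block k : code (block k) = [seq (x == 0, x == k) | x <- iota 0 k.+1].
Proof.
have bP : [fset x in iota 0 k.+1]%fset \in blocks (block k) by apply/fset1P.
apply/eq_in_map => x; rewrite mem_iota add0n /= => lx.
have xb : x \in [fset x in iota 0 k.+1]%fset by rewrite in_fset mem_iota.
congr pair; apply/(extremalP _ bP xb)/eqP => [H|-> y].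
- by have := H 0; rewrite in_fset mem_iota /= => /(_ isT); rewrite leqn0 => /eqP.
- by [].
- move: (H k); rewrite in_fset mem_iota /= add0n ltnSn => /(_ isT) /= le.
  by apply/eqP; rewrite eqn_leq le -ltnS lx.
- by rewrite in_fset mem_iota.
Qed.

Lemma size_code_block k : size (code (block k)) = k.+1.
Proof. by rewrite size_code. Qed.

Lemma nth_code_block k i x0 : i <= k -> nth x0 (code (block k)) i = (i == 0, i == k).
Proof. by move=> lt; rewrite code_block (nth_map 0) ?size_iota // nth_iota. Qed.

(** * Removing the block that closes first *)

Lemma block_max p V : V \in blocks p -> exists2 z, z \in V & extremal false p z.
Proof.
move=> VP; have [x xV] := blocks_ne VP.
have B : forall y, y \in V -> y <= ncsize p by move=> y /(blocks_lt VP) /ltnW.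
case: (ex_maxnP (ex_intro _ x xV) B) => z zV M.
by exists z => //; apply/(extremalP _ VP zV) => y /M.
Qed.

(** Deleting an interval block [V = [a, a + k]] from a partition. *)
Section Deletion.
Variables (p : ncpart) (V : {fset nat}) (a k : nat).
Hypotheses (VP : V \in blocks p) (Vak : forall x, (x \in V) = (a <= x <= a + k)).

(* [down] renumbers the positions outside of [V], and [up] is its inverse. *)
Let down x := if x < a then x else x - k.+1.
Let up y := if y < a then y else y + k.+1.
Let n0 := ncsize p - k.+1.
Let P0 := relabel down (blocks p `\ V)%fset.

Let le_ak : a + k < ncsize p.
Proof. by apply: (blocks_lt VP); rewrite Vak leq_addr leqnn. Qed.

Let upK y : down (up y) = y.
Proof. by rewrite /down /up; case: ifP; case: ifP; lia. Qed.

Let upNV y : up y \notin V.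
Proof. by rewrite Vak /up; case: ifP; lia. Qed.

Let downK x : x \notin V -> up (down x) = x.
Proof. by rewrite Vak /up /down; case: ifP; case: ifP; lia. Qed.

Let up_mono : {mono up : x y / x <= y}.
Proof.
by apply: leq_mono => x y; rewrite /up; case: ifP; case: ifP; lia.
Qed.

Let up_lt y : (up y < ncsize p) = (y < n0).
Proof. by rewrite /up /n0; case: (ltnP y a) => ?; move: le_ak; lia. Qed.

Let disj U x : U \in blocks p -> U != V -> x \in U -> x \notin V.
Proof.
by move=> UP ne xU; apply: contra ne => xV; apply/eqP; apply: blocks_inj UP VP xU xV.
Qed.

Let mem_down U y : U \in blocks p -> U != V ->
  (y \in [fset down x | x in U]%fset) = (up y \in U).
Proof.
move=> UP ne; apply/imfsetP/idP => [[x /= xU ->]|yU].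
  by rewrite downK // (disj UP ne).
by exists (up y) => //; rewrite upK.
Qed.

(* The blocks of the new partition are the preimages under [up] of the blocks of
   [p] other than [V]. *)
Let P0P U0 : U0 \in P0 ->
  exists U, [/\ U \in blocks p, U != V & forall y, (y \in U0) = (up y \in U)].
Proof.
case/imfsetP => U /=; rewrite in_fsetD1 => /andP [ne UP] ->.
by exists U; split=> // y; rewrite mem_down.
Qed.

Let P0_in U : U \in blocks p -> U != V -> [fset down x | x in U]%fset \in P0.
Proof. by move=> UP ne; apply/imfsetP; exists U => //=; rewrite in_fsetD1 ne. Qed.

Lemma is_ncpart_del : is_ncpart n0 P0.
Proof.
apply/is_ncpartP; split.
- by move=> U0 x /P0P [U [UP _ H]]; rewrite H => /(blocks_lt UP); rewrite up_lt.
- move=> x; rewrite -up_lt => /blocks_ex [U UP xU].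
  have ne : U != V by apply: contraNneq (upNV x) => <-.
  by exists [fset down x | x in U]%fset; [apply: P0_in|rewrite mem_down].
- move=> U0 W0 x /P0P [U [UP _ HU]] /P0P [W [WP _ HW]].
  rewrite HU HW => xU xW; apply/fsetP => y.
  by rewrite HU HW (blocks_inj UP WP xU xW).
- move=> U0 /imfsetP [U /=]; rewrite in_fsetD1 => /andP [ne UP] ->.
  have [x xU] := blocks_ne UP; exists (down x).
  by apply/imfsetP; exists x.
- move=> U0 W0 x y z t /P0P [U [UP _ HU]] /P0P [W [WP _ HW]].
  rewrite !HU !HW => xU yW zU tW xy yz zt; apply/fsetP => s; rewrite HU HW.
  by rewrite (blocks_nc UP WP xU yW zU tW) // (leqW_mono up_mono).
Qed.

(** The partition [p] without its interval block [V]. *)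
Definition delpart : ncpart := @NCPart (n0, P0) is_ncpart_del.

Lemma extremal_del b y : extremal b delpart y = extremal b p (up y).
Proof.
have mono x z : lebool b (up x) (up z) = lebool b x z by case: b; apply: up_mono.
apply/asboolP/asboolP => [[U0 /P0P [U [UP ne HU]] [yU H]]|[U UP [yU H]]].
  exists U; rewrite // -HU; split=> // z zU.
  by rewrite -(downK (disj UP ne zU)) mono; apply: H; rewrite HU downK ?(disj UP ne zU).
have ne : U != V by apply: contraNneq (upNV y) => <-.
exists [fset down x | x in U]%fset; first exact: P0_in.
rewrite mem_down //; split=> // z; rewrite mem_down // => zU.
by rewrite -mono; apply: H.
Qed.

Lemma card_blocks_del : #|` blocks p| = #|` blocks delpart|.+1.
Proof.
rewrite (cardfsD1 V) VP add1n; congr _.+1; symmetry; apply: card_in_imfset => U W /=.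
rewrite !in_fsetD1 => /andP [neU UP] /andP [neW WP] e.
have [x xU] := blocks_ne UP; have e' := downK (disj UP neU xU).
have : down x \in [fset down x | x in W]%fset by rewrite -e; apply/imfsetP; exists x.
by rewrite mem_down // e' => /(blocks_inj UP WP xU).
Qed.

Lemma code_del : a <= ncsize delpart /\
  code p = take a (code delpart) ++ code (block k) ++ drop a (code delpart).
Proof.
have le : a <= n0 by rewrite /n0; move: le_ak; lia.
split=> //; rewrite /code -map_take -map_drop take_iota drop_iota (minn_idPl le).
have -> : ncsize p = a + (k.+1 + (n0 - a)) by rewrite /n0; move: le_ak; lia.
rewrite 2!iotaD !map_cat add0n; congr cat; last congr cat.
- apply/eq_in_map => x; rewrite mem_iota add0n /= => lx.
  by rewrite !extremal_del /up lx.
- rewrite -{1}[a]addn0 iotaDl -map_comp; apply/eq_in_map => x.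
  rewrite mem_iota add0n => /= lx.
  have xV : a + x \in V by rewrite Vak; lia.
  have := nth_code (true, true) (lx : x < ncsize (block k)).
  rewrite nth_code_block // => <-; congr pair; apply/(extremalP _ VP xV)/eqP.
  + by move/(_ a); rewrite Vak /= => /(_ _); lia.
  + by move=> -> y; rewrite Vak /=; lia.
  + by move/(_ (a + k)); rewrite Vak /= => /(_ _); lia.
  + by move=> -> y; rewrite Vak /=; lia.
- rewrite [a + k.+1]addnC iotaDl -map_comp; apply/eq_in_map => x.
  rewrite mem_iota => /= lx; rewrite !extremal_del /up.
  by rewrite ltnNge; case/andP: lx => -> _ /=; rewrite addnC.
Qed.
End Deletion.

(** Every non-empty partition arises by inserting a one-block partition so that
   its block closes before every other block. *)
Lemma first_closed_block p : p <> ncempty ->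
  exists a k p0, [/\ a <= ncsize p0,
    code p = take a (code p0) ++ code (block k) ++ drop a (code p0),
    ~~ has snd (take a (code p0)) & #|` blocks p| = #|` blocks p0|.+1].
Proof.
move=> pN.
have p_gt0 : 0 < ncsize p.
  rewrite lt0n; apply: contra_notN pN => /eqP e; apply: code_nil; apply: size0nil.
  by rewrite size_code.
have E : exists m, extremal false p m.
  by have [V /block_max [z _ ez] _] := blocks_ex p_gt0; exists z.
(* [m] is the first closing position: its block cannot enclose another one. *)
case: (ex_minnP E) => m em Mm {E}.
have lm := extremal_lt em; have [V VP mV] := blocks_ex lm.
have Vm x : x \in V -> x <= m by move/(extremalP _ VP mV): em => /(_ x).
case: (ex_minnP (ex_intro (fun x => x \in V) m mV)) => a aV Ma.
have le := Vm _ aV.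
have Vam x : (x \in V) = (a <= x <= a + (m - a)).
  rewrite subnKC //; apply/idP/idP => [xV|/andP [ax]]; first by rewrite Ma ?Vm.
  rewrite leq_eqVlt => /predU1P [->//|xm].
  have [W WP xW] := blocks_ex (ltn_trans xm lm).
  have [<-//|ne] := eqVneq W V.
  have ax' : a < x.
    rewrite ltn_neqAle ax andbT; apply: contra ne => /eqP e; apply/eqP.
    by apply: (blocks_inj WP VP xW); rewrite -e.
  have [z zW ez] := block_max WP.
  have mz : m < z.
    rewrite ltn_neqAle Mm // andbT; apply: contra ne => /eqP e; apply/eqP.
    by apply: (blocks_inj WP VP zW); rewrite -e.
  by rewrite (blocks_nc VP WP aV xW mV zW ax' xm mz).
have [le0 ec] := code_del VP Vam.
exists a, (m - a), (delpart VP Vam); split=> //; last exact: card_blocks_del.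
apply/(has_nthP (false, false)) => -[x]; rewrite size_takel ?size_code // => lx.
rewrite nth_take // nth_code ?(leq_trans lx) //= extremal_del lx => /Mm.
by rewrite leqNgt (leq_trans lx le).
Qed.

(** * Grafting a one-block partition *)

Lemma count_code_block k : count fst (code (block k)) = 1.
Proof.
rewrite code_block /= count_map -[RHS]addn0; congr addn.
apply/eqP; rewrite -leqn0 leqNgt -has_count; apply/hasPn => x.
by rewrite mem_iota /= => /andP [h _]; rewrite -lt0n.
Qed.

Lemma has_code_block k : has snd (code (block k)).
Proof.
apply/(has_nthP (false, false)); exists k; first by rewrite size_code_block.
by rewrite nth_code_block //= eqxx.
Qed.

Lemma find_code_block k : find snd (code (block k)) = k.
Proof.
have lt : find snd (code (block k)) <= k.
  by rewrite -ltnS -(size_code_block k) -has_find has_code_block.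
have := nth_find (false, false) (has_code_block k).
by rewrite nth_code_block //= => /eqP.
Qed.

Lemma card_blocks p : #|` blocks p| = count fst (code p).
Proof.
have [n] := ubnP (ncsize p); elim: n p => // n IH p; rewrite ltnS => le.
have [->|/eqP pN] := eqVneq p ncempty; first exact: cardfs0.
have [a [k [p0 [la e _ ->]]]] := first_closed_block pN.
have := congr1 size e; rewrite !size_cat size_code_block size_take size_drop !size_code => es.
rewrite IH; last by move: es; case: ifP; lia.
by rewrite e !count_cat count_code_block addnCA -count_cat cat_take_drop.
Qed.

(** The block of [k.+1] elements followed by [p] on its right. *)
Definition prepend k p := gap_ins (block k) (nseq k.+1 ncempty ++ [:: p]).

Lemma code_prepend k p : code (prepend k p) = code (block k) ++ code p.
Proof.
rewrite /prepend code_gap_ins map_cat map_code_nseq -(size_code_block k).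
by rewrite -{1}[code (block k)]cats0 interleave_nil_l /= cats0.
Qed.

Lemma prepend_neq0 k p : prepend k p != ncempty.
Proof.
by apply/eqP => /(congr1 code) /(congr1 size); rewrite code_prepend size_cat size_code_block.
Qed.

(** The block of [k.+1] elements inserted in the [a]-th gap of [p]. *)
Definition insert_block a k p :=
  gap_ins p (nseq a ncempty ++ block k :: nseq (ncsize p - a) ncempty).

Lemma code_insert_block a k p : a <= ncsize p ->
  code (insert_block a k p) = take a (code p) ++ code (block k) ++ drop a (code p).
Proof.
move=> le; rewrite /insert_block code_gap_ins map_cat /= !map_code_nseq.
have sa : size (take a (code p)) = a by rewrite size_takel ?size_code.
have -> : nseq a [::] = nseq (size (take a (code p))) [::] :> seq (seq (bool * bool)).
  by rewrite sa.
rewrite -{1}(cat_take_drop a (code p)) interleave_nil_l.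
rewrite -[code (block k)]cats0 interleave_cat_hd; congr (_ ++ (_ ++ _)).
have -> : [::] :: nseq (ncsize p - a) [::] = nseq (size (drop a (code p))).+1 [::] :> seq (seq (bool * bool)).
  by rewrite size_drop size_code.
by rewrite interleave_nils.
Qed.

Lemma nth_insert_block a k (c : seq (bool * bool)) i : a <= size c ->
  a <= i <= a + k ->
  (nth (false, false) (take a c ++ code (block k) ++ drop a c) i).1 = (i == a).
Proof.
move=> la li; rewrite !nth_cat size_takel // size_code_block.
case/andP: li => ai iak; rewrite ltnNge ai /=.
have l2 : i - a < k.+1 by lia.
by rewrite l2 nth_code_block //= subn_eq0 eqn_leq ai andbT.
Qed.

Lemma is_interval_prepend k p :
  `[< is_interval p >] -> `[< is_interval (prepend k p) >].
Proof.
rewrite !is_intervalE code_prepend => /(sortedP (false, false)) S.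
apply/(sortedP (false, false)) => i; rewrite size_cat size_code_block => li.
rewrite !nth_cat size_code_block; case: (ltngtP i k) => ik.
- by rewrite ltnW // ltnS ik !nth_code_block ?(ltnW ik) // /adjacent /= ltn_eqF.
- have [-> ->] : (i < k.+1) = false /\ (i.+1 < k.+1) = false by split; lia.
  by rewrite subSn //; apply: S; lia.
- subst i; rewrite ltnSn ltnn subnn nth_code_block // /adjacent eqxx /=.
  have p0 : 0 < ncsize p by move: li; rewrite size_code; lia.
  rewrite nth_code //=; have [U UP xU] := blocks_ex p0.
  by rewrite eq_sym eqb_id; apply/(extremalP _ UP xU).
Qed.

(** In an interval partition the block that closes first is at the very left. *)
Lemma interval_prepend p : p != ncempty -> `[< is_interval p >] ->
  exists k p0, p = prepend k p0 /\ `[< is_interval p0 >].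
Proof.
move=> /eqP pN; rewrite is_intervalE => S.
have [a [k [p0 [la e h _]]]] := first_closed_block pN.
have a0 : a = 0.
  case: a la e h => // a la e /hasPn h.
  have st : size (take a.+1 (code p0)) = a.+1 by rewrite size_takel ?size_code.
  have sc : size (code p) = a.+1 + (k.+1 + size (drop a.+1 (code p0))).
    by rewrite e !size_cat st size_code_block.
  have := elimT (sortedP (false, false)) S a; rewrite sc => /(_ ltac:(lia)).
  rewrite /adjacent {1 2}e !nth_cat st ltnSn ltnn subnn nth_code_block //=.
  have := h (nth (false, false) (take a.+1 (code p0)) a).
  by rewrite mem_nth ?st // => /(_ isT) /negbTE ->.
rewrite a0 take0 drop0 cat0s in e.
exists k, p0; split; first by apply: code_inj; rewrite code_prepend.
rewrite is_intervalE; have := drop_sorted (k.+1) S.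
by rewrite e drop_size_cat // size_code_block.
Qed.

(** * Factorizations of a partition *)

(** The pairs [(a, b)] such that inserting the word [b] in the gaps of [a] gives [p]. *)
Definition fact (p : ncpart) : seq (ncpart * seq ncpart) :=
  [seq (tag x, val (tagged x)) |
    x : {a : ncpart & ncword (arity a) (arity p)} <- fset_set (factors p)].

Lemma inputs_fact p b a : gap_ins a b = p -> size b = arity a -> inputs arity b = arity p.
Proof. by move=> <- /arity_gap_ins. Qed.

Lemma factorsP p (x : {a : ncpart & ncword (arity a) (arity p)}) :
  factors p x <-> gap_ins (tag x) (val (tagged x)) = p.
Proof.
case: x => a w; rewrite /factors /=; split=> [/(congr1 val)|e].
  by rewrite /= nabla_cons take_oversize ?word_n // => -[].
by apply: val_inj; rewrite /= nabla_cons take_oversize ?word_n ?e.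
Qed.

Lemma mem_fact p x : (x \in fact p) = (size x.2 == arity x.1) && (gap_ins x.1 x.2 == p).
Proof.
apply/mapP/andP => [[y]|[/eqP s /eqP e]].
  rewrite in_fset_set; last exact: finite_factors.
  by move=> /asboolP /factorsP e ->; rewrite word_n e !eqxx.
pose w : ncword (arity x.1) (arity p) := mkword s (inputs_fact e s).
exists (Tagged (fun a => ncword (arity a) (arity p)) w); last exact: surjective_pairing.
rewrite in_fset_set; last exact: finite_factors.
by apply/mem_set/factorsP.
Qed.

Lemma fact_uniq p : uniq (fact p).
Proof.
rewrite map_inj_uniq ?fset_uniq // => -[a u] [b v] /= [e1 e2].
by subst b; congr existT; apply: val_inj.
Qed.

Lemma fact_ncempty : fact ncempty = [:: (ncempty, [:: ncempty])].
Proof.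
apply: perm_small_eq => //; apply: uniq_perm => //; first exact: fact_uniq.
move=> [a b]; rewrite mem_fact inE /=; apply/andP/eqP => [[/eqP s /eqP e]|[-> ->]].
  have ea : a = ncempty.
    apply: code_nil; apply: size0nil; rewrite size_code; apply/eqP; rewrite -leqn0.
    by have := ncsize_gap_ins a b; rewrite e.
  subst a; case: b s e => [|b []] //= _ <-; by rewrite gap_ins_ncempty.
by rewrite gap_ins_ncempty.
Qed.

(** * The sign of a word, and the sum of signs over factorizations *)

Lemma find_closer a k (c c' : seq (bool * bool)) : ~~ has snd (take a c) ->
  a <= size c -> find snd (take a c ++ code (block k) ++ c') = a + k.
Proof.
move=> /negbTE h le; rewrite find_cat h size_takel //; congr addn.
by rewrite find_cat has_code_block find_code_block.
Qed.

(** The block closing first can be read off the word: it ends at the first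
   closing position, and begins at the last opening position before it. *)
Lemma insert_block_inj a k p a' k' p' :
  a <= ncsize p -> ~~ has snd (take a (code p)) ->
  a' <= ncsize p' -> ~~ has snd (take a' (code p')) ->
  insert_block a k p = insert_block a' k' p' -> [/\ a = a', k = k' & p = p'].
Proof.
move=> la h la' h' /(congr1 code); rewrite !code_insert_block //.
rewrite -size_code in la; rewrite -size_code in la'.
move=> e; have := congr1 (find snd) e; rewrite !find_closer // => ek.
have ea : a = a'.
  apply/eqP; case/orP: (leq_total a a') => le.
    have l1 : a <= a' <= a + k by rewrite le ek leq_addr.
    have l2 : a' <= a' <= a' + k' by rewrite leqnn leq_addr.
    by rewrite eq_sym -(nth_insert_block la l1) e nth_insert_block.
  have l1 : a' <= a <= a' + k' by rewrite le -ek leq_addr.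
  have l2 : a <= a <= a + k by rewrite leqnn leq_addr.
  by rewrite -(nth_insert_block la' l1) -e nth_insert_block.
subst a'; have ek' : k = k' by lia.
subst k'; split=> //; apply: code_inj; rewrite -(cat_take_drop a (code p)).
move/eqP: e; rewrite eqseq_cat; last by rewrite !size_takel.
by case/andP => /eqP ->; rewrite eqseq_cat // eqxx => /eqP ->; rewrite cat_take_drop.
Qed.

Lemma prepend_inj k p k' p' : prepend k p = prepend k' p' -> k = k' /\ p = p'.
Proof.
move=> /(congr1 code); rewrite !code_prepend => e.
have := congr1 (find snd) e; rewrite !find_cat !has_code_block !find_code_block => ek.
by subst k'; split=> //; apply: code_inj; move/eqP: e; rewrite eqseq_cat // eqxx => /eqP.
Qed.

Lemma nseq_cat_inj (T : eqType) (x0 y y' : T) a r a' r' : y != x0 -> y' != x0 ->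
  nseq a x0 ++ y :: r = nseq a' x0 ++ y' :: r' -> [/\ a = a', y = y' & r = r'].
Proof.
move=> yx yx'; elim: a a' => [|a IH] [|a'] //=.
- by case=> -> ->.
- by case=> e; rewrite e eqxx in yx.
- by case=> e; rewrite -e eqxx in yx'.
- by case=> /IH [-> -> ->].
Qed.

Section SignSum.
Variable R : comNzRingType.
Local Open Scope ring_scope.

(** The coefficient of the antipode on a letter. *)
Definition sign (p : ncpart) : R :=
  if `[< is_interval p >] then (-1) ^+ #|` blocks p| else 0.

(** The coefficient of the antipode on a word. *)
Definition word_sign (w : seq ncpart) : R := \prod_(p <- w) sign p.

Lemma is_interval_ncempty : `[< is_interval ncempty >].
Proof. by rewrite is_intervalE. Qed.

Lemma sign_ncempty : sign ncempty = 1.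
Proof. by rewrite /sign is_interval_ncempty card_blocks. Qed.

Lemma word_sign_cat u v : word_sign (u ++ v) = word_sign u * word_sign v.
Proof. exact: big_cat. Qed.

Lemma word_sign_cons p v : word_sign (p :: v) = sign p * word_sign v.
Proof. exact: big_cons. Qed.

Lemma word_sign_nseq n : word_sign (nseq n ncempty) = 1.
Proof. by rewrite /word_sign big_nseq; elim: n => //= n ->; rewrite sign_ncempty mul1r. Qed.

Lemma sign_prepend k p : `[< is_interval p >] -> sign (prepend k p) = - sign p.
Proof.
move=> Ip; rewrite /sign is_interval_prepend // Ip !card_blocks code_prepend.
by rewrite count_cat count_code_block exprS mulN1r.
Qed.

Lemma word_sign0 w : ~~ all (fun p => `[< is_interval p >]) w -> word_sign w = 0.
Proof.
elim: w => //= p w IH; rewrite negb_and word_sign_cons => /orP [/negbTE h|/IH ->].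
  by rewrite /sign h mul0r.
by rewrite mulr0.
Qed.

(** For a non-empty partition, the factorizations with a word of interval
   partitions cancel in pairs. The block of [p] that closes first belongs either
   to the inserted word or to the outer partition, and it can be moved from one to
   the other, which changes the sign. A tuple [(p0, a, k, b, r)] encodes both
   factorizations of such a pair: with [a] empty partitions in front, the first
   one inserts [prepend k b] and [r] into [p0]; with [a + k.+1] of them in front,
   the second one inserts [b] and [r] into [insert_block a k p0]. *)
Section Toggle.
Variable p : ncpart.
Hypothesis pN : p <> ncempty.

Let T : Type := (ncpart * nat * nat * ncpart * seq ncpart)%type.
Let isint q := `[< is_interval q >].

Let inner (t : T) : ncpart * seq ncpart :=
  let: (p0, a, k, b, r) := t in (p0, nseq a ncempty ++ prepend k b :: r).
Let outer (t : T) : ncpart * seq ncpart :=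
  let: (p0, a, k, b, r) := t in
  (insert_block a k p0, nseq (a + k.+1)%N ncempty ++ b :: r).
Let ok (t : T) : bool :=
  let: (p0, a, k, b, r) := t in
  [&& (a <= ncsize p0)%N, ~~ has snd (take a (code p0)),
      inner t \in fact p & all isint (b :: r)].

Let X := [seq x <- fact p | all isint x.2].
(* The first non-empty letter of the word comes before the first closing position
   of the outer partition. *)
Let isinner (x : ncpart * seq ncpart) : bool :=
  has (predC1 ncempty) x.2 &&
  ~~ has snd (take (find (predC1 ncempty) x.2) (code x.1)).

Let all_nseq n w : all isint (nseq n ncempty ++ w) = all isint w.
Proof. by rewrite all_cat all_nseq /isint is_interval_ncempty orbT. Qed.

Let outer_fact p0 a k b r : (a <= ncsize p0)%N ->
  (outer (p0, a, k, b, r) \in fact p) = (inner (p0, a, k, b, r) \in fact p).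
Proof.
move=> la; rewrite !mem_fact /= !size_cat /= !size_nseq.
have sa : size (take a (code p0)) = a by rewrite size_takel ?size_code.
congr andb.
  rewrite /arity -size_code code_insert_block // !size_cat size_code_block sa.
  by rewrite size_drop size_code; apply/eqP/eqP; lia.
congr (_ == _); apply: code_inj; rewrite code_gap_ins [RHS]code_gap_ins code_insert_block //.
rewrite !map_cat !map_cons !map_code_nseq code_prepend catA.
have -> : nseq (a + k.+1)%N [::] =
    nseq (size (take a (code p0) ++ code (block k))) [::] :> seq (seq (bool * bool)).
  by rewrite size_cat sa size_code_block.
rewrite interleave_nil_l -[in RHS](cat_take_drop a (code p0)).
have -> : nseq a [::] = nseq (size (take a (code p0))) [::] :> seq (seq (bool * bool)).
  by rewrite sa.
by rewrite interleave_nil_l interleave_cat_hd catA.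
Qed.

Let inner_in t : ok t -> (inner t \in X) && isinner (inner t).
Proof.
case: t => [[[[p0 a] k] b] r] /and4P [la h F] /andP [Ib Ir].
have I : all isint (nseq a ncempty ++ prepend k b :: r).
  by rewrite all_nseq; apply/andP; split; first exact: is_interval_prepend.
rewrite mem_filter F [all _ _]I andbT /=.
rewrite /isinner /= has_cat /= orbT find_cat.
by rewrite has_nseq andbF size_nseq addn0.
Qed.

Let outer_in t : ok t -> (outer t \in X) && ~~ isinner (outer t).
Proof.
case: t => [[[[p0 a] k] b] r] /and4P [la h F I].
rewrite mem_filter outer_fact // F all_nseq I /=.
rewrite negb_and negbK /= find_cat has_nseq andbF size_nseq.
case: (boolP (has _ _)) => //= _.
rewrite code_insert_block // catA take_cat size_cat size_code_block size_takel ?size_code //.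
by rewrite ltnNge leq_addr /= !has_cat has_code_block orbT.
Qed.

Let inner_inj t t' : ok t -> ok t' -> inner t = inner t' -> t = t'.
Proof.
case: t => [[[[p0 a] k] b] r] _; case: t' => [[[[p0' a'] k'] b'] r'] _ [<-].
by case/(nseq_cat_inj (prepend_neq0 _ _) (prepend_neq0 _ _)) => -> /prepend_inj [-> ->] ->.
Qed.

Let outer_inj' t t' : ok t -> ok t' -> outer t = outer t' -> t = t'.
Proof.
case: t => [[[[p0 a] k] b] r] /and4P [la h _ _].
case: t' => [[[[p0' a'] k'] b'] r'] /and4P [la' h' _ _] e.
have e1 : insert_block a k p0 = insert_block a' k' p0' := congr1 fst e.
move: (congr1 snd e).
case: (insert_block_inj la h la' h' e1) => <- <- <- /eqP /=.
by rewrite eqseq_cat // eqxx => /eqP [-> ->].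
Qed.

Let cat_nseq_find (w : seq ncpart) n : (n <= find (predC1 ncempty) w)%N ->
  (n <= size w)%N -> w = nseq n ncempty ++ drop n w.
Proof.
elim: n w => [|n IH] [|x w] //=; rewrite ?drop0 //.
by case: eqP => //= -> l1 l2; rewrite -IH.
Qed.

Let inner_surj x : x \in X -> isinner x -> exists2 t, ok t & inner t = x.
Proof.
case: x => p0 w; rewrite mem_filter /isinner /= => /andP [I F] /andP [hw hc].
set a := find _ w in hc.
have la : (a < size w)%N by rewrite -has_find.
have ew := @cat_nseq_find w a (leqnn _) (ltnW la).
have nz := nth_find ncempty hw; rewrite -/a in nz.
rewrite (drop_nth ncempty la) in ew.
move: (I); rewrite ew all_nseq /= => /andP [Iq Ir].
have [k [b [eb Ib]]] := interval_prepend nz Iq.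
exists (p0, a, k, b, drop a.+1 w); last by rewrite /= -eb -ew.
rewrite /ok /inner -eb -ew F hc /= [isint b]Ib Ir !andbT.
by move: F; rewrite mem_fact /= => /andP [/eqP s _]; move: la; rewrite s.
Qed.

Let outer_surj x : x \in X -> ~~ isinner x -> exists2 t, ok t & outer t = x.
Proof.
case: x => q w; rewrite mem_filter /isinner /= => /andP [I F].
move: (F); rewrite mem_fact => /= /andP [/eqP s /eqP e] N.
have qN : q <> ncempty.
  move=> qe; subst q; case/negP: N.
  case: w s e {I F} => [|y [|]] //= _; rewrite gap_ins_ncempty => ->.
  by rewrite andbT orbF; apply/eqP.
have [a [k [p0 [la ec h _]]]] := first_closed_block qN.
have eq : q = insert_block a k p0 by apply: code_inj; rewrite code_insert_block.
have sq : ncsize q = (ncsize p0 + k.+1)%N.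
  rewrite -size_code ec !size_cat size_code_block size_takel ?size_drop size_code //.
  by move: la; lia.
have lw : (a + k.+1 < size w)%N by rewrite s /arity sq; move: la; lia.
have lf : (a + k.+1 <= find (predC1 ncempty) w)%N.
  move: N; rewrite negb_and negbK => /orP [hw|].
    rewrite leqNgt; apply: contra hw => hf; rewrite has_find.
    by apply: leq_trans hf _; apply: ltnW.
  rewrite leqNgt; apply: contraL => hf; rewrite ec catA.
  rewrite take_cat size_cat size_code_block size_takel ?size_code // hf.
  rewrite take_cat size_takel ?size_code //; case: ltnP => l2.
    by move: h; rewrite -{1}(cat_take_drop (find (predC1 ncempty) w) (take a _)) has_cat negb_or => /andP [].
  rewrite has_cat negb_or h /=; apply/(has_nthP (false, false)) => -[x].
  have l3 : (find (predC1 ncempty) w - a < k.+1)%N by lia.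
  rewrite size_takel ?size_code_block; last exact: ltnW.
  move=> lx; rewrite nth_take // nth_code_block /=; last exact: leq_trans (ltnW lx) l3.
  by move/eqP => ex; move: l3; rewrite ltnS leqNgt -ex lx.
have ew := cat_nseq_find lf (ltnW lw).
rewrite (drop_nth ncempty lw) in ew.
move: (I); rewrite {1}ew all_nseq => Ir.
exists (p0, a, k, nth ncempty w (a + k.+1), drop (a + k.+1).+1 w); last by rewrite /= -eq -ew.
rewrite /ok la h Ir -outer_fact // andbT.
by rewrite /= -eq -ew.
Qed.

Let choose (s : seq (ncpart * seq ncpart)) :
  {subset s <= X} -> all isinner s -> exists2 ts, all ok ts & map inner ts = s.
Proof.
elim: s => [|x s IH] sX /=; first by exists [::].
case/andP => ix /IH [|ts okts <-]; first by move=> y ys; apply: sX; rewrite inE ys orbT.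
have [t okt <-] := inner_surj (sX x (mem_head _ _)) ix.
by exists (t :: ts); rewrite //= okt.
Qed.

Lemma sum_word_sign_neq0 : \sum_(x <- fact p) word_sign x.2 = 0.
Proof.
rewrite (bigID (fun x : ncpart * seq ncpart => all isint x.2)) /= [X in _ + X]big1 => [|x]; last first.
  exact: word_sign0.
rewrite addr0 -big_filter -/X (bigID isinner) /= -big_filter -[X in _ + X]big_filter.
have uX : uniq X by rewrite filter_uniq ?fact_uniq.
have sX : {subset [seq x <- X | isinner x] <= X}.
  by move=> x; rewrite mem_filter => /andP [].
have [ts okts ets] := choose sX (filter_all _ _).
have okt t : t \in ts -> ok t by move/allP: okts; apply.
have uts : uniq ts by apply: (map_uniq (f := inner)); rewrite ets filter_uniq.
have pe : perm_eq [seq x <- X | ~~ isinner x] (map outer ts).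
  apply: uniq_perm; first exact: filter_uniq.
    by rewrite map_inj_in_uniq // => t t' /okt h /okt h'; apply: outer_inj'.
  move=> x; rewrite mem_filter; apply/andP/mapP => [[nx xX]|[t /okt h ->]]; last first.
    by have /andP [] := outer_in h.
  have [t okt' et] := outer_surj xX nx; exists t => //.
  have /andP [i1 i2] := inner_in okt'.
  have : inner t \in map inner ts by rewrite ets mem_filter i1 i2.
  by case/mapP => t' t't e; rewrite (inner_inj okt' (okt _ t't) e).
rewrite (perm_big _ pe) -ets !big_map -big_split big_seq big1 // => -[[[[p0 a] k] b] r] /okt.
case/and4P => _ _ _ /andP [Ib _] /=.
rewrite !word_sign_cat !word_sign_nseq !word_sign_cons sign_prepend //.
by rewrite !mul1r mulNr addNr.
Qed.
End Toggle.

Lemma sum_word_sign p : \sum_(x <- fact p) word_sign x.2 = (p == ncempty)%:R.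
Proof.
have [->|/eqP pN] := eqVneq p ncempty; last exact: sum_word_sign_neq0.
by rewrite fact_ncempty big_seq1 -(word_sign_nseq 1).
Qed.
End SignSum.

(** * Factorizations of words *)

(** The pairs [(u, v)] of words with [nabla_word u v = w], letter by letter. *)
Fixpoint word_fact (w : seq ncpart) : seq (seq ncpart * seq ncpart) :=
  if w is p :: w' then
    [seq (x.1 :: y.1, x.2 ++ y.2) | x <- fact p, y <- word_fact w']
  else [:: ([::], [::])].

Lemma mem_word_fact w u v :
  ((u, v) \in word_fact w) = (size v == inputs arity u) && (nabla_word u v == w).
Proof.
elim: w u v => [|p w IH] u v.
  rewrite inE; apply/eqP/andP => [[-> ->] //|[sv /eqP e]].
  case: u sv e => [|//] sv _; congr pair; exact/size0nil/eqP.
apply/allpairsP/andP => [[[[a b] [u' v']] /= []]|[/eqP sv /eqP e]].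
  rewrite mem_fact /= IH => /andP [/eqP sb /eqP e] /andP [/eqP sv' /eqP e'] [-> ->].
  rewrite size_cat sb sv' inputs_cons eqxx nabla_cons; split=> //.
  by rewrite take_size_cat // drop_size_cat // e e'.
case: u sv e => [//|a u]; rewrite inputs_cons nabla_cons => sv [e e'].
exists ((a, take (arity a) v), (u, drop (arity a) v)); rewrite /= mem_fact IH /= e e' !eqxx.
by rewrite size_takel ?size_drop sv ?leq_addr // addKn !eqxx cat_take_drop.
Qed.

Lemma word_fact_uniq w : uniq (word_fact w).
Proof.
elim: w => //= p w IH; apply: allpairs_uniq => //; first exact: fact_uniq.
move=> [[a b] [u v]] [[a' b'] [u' v']] /allpairsP [[[a1 b1] [u1 v1]] [/= h1 _ [-> -> -> ->]]].
case/allpairsP => [[[a2 b2] [u2 v2]] [/= h2 _ [-> -> -> ->]]] [e1 e2 /eqP].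
move: h1 h2; rewrite !mem_fact /= => /andP [/eqP s1 _] /andP [/eqP s2 _].
by subst a2; rewrite e2 eqseq_cat ?s1 ?s2 // => /andP [/eqP -> /eqP ->].
Qed.

Lemma word_fact_nseq n :
  word_fact (nseq n ncempty) = [:: (nseq n ncempty, nseq n ncempty)].
Proof. by elim: n => //= n ->; rewrite fact_ncempty. Qed.

Section WordFactSums.
Local Open Scope ring_scope.

Lemma sum_uniq1 (T : eqType) (V : nmodType) (s : seq T) x0 (F : T -> V) :
  uniq s -> x0 \in s -> (forall x, x \in s -> x != x0 -> F x = 0) ->
  \sum_(x <- s) F x = F x0.
Proof.
move=> us xs F0; rewrite (bigD1_seq x0) //= big_seq_cond big1 ?addr0 // => x /andP [].
exact: F0.
Qed.

Lemma sum_word_fact_cat (V : nmodType) (F : seq ncpart * seq ncpart -> V) w1 w2 :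
  \sum_(x <- word_fact (w1 ++ w2)) F x =
  \sum_(x <- word_fact w1) \sum_(y <- word_fact w2) F (x.1 ++ y.1, x.2 ++ y.2).
Proof.
elim: w1 F => [|p w1 IH] F /=.
  by rewrite big_seq1; apply: eq_bigr => -[].
rewrite !big_allpairs_dep; apply: eq_bigr => x _.
rewrite IH; apply: eq_bigr => y _; apply: eq_bigr => z _ /=.
by rewrite catA.
Qed.

(** Both sides sum over the factorizations of [w] into three words. *)
Lemma sum_word_fact_assoc (V : nmodType)
    (F : seq ncpart -> seq ncpart -> seq ncpart -> V) w :
  \sum_(x <- word_fact w) \sum_(y <- word_fact x.1) F y.1 y.2 x.2 =
  \sum_(x <- word_fact w) \sum_(y <- word_fact x.2) F x.1 y.1 y.2.
Proof.
pose P2 : Type := (seq ncpart * seq ncpart)%type.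
have mem_st (t : P2 -> seq P2) (p : {x : P2 & P2}) :
    p \in [seq existT (fun=> P2) x y | x <- word_fact w, y <- t x] -> tagged p \in t (tag p).
  by case/allpairsPdep => x [y [_ h ->]].
pose G (t : seq ncpart * seq ncpart * seq ncpart) := F t.1.1 t.1.2 t.2.
transitivity (\sum_(t <- [seq (y.1, y.2, x.2) | x <- word_fact w, y <- word_fact x.1]) G t).
  by rewrite big_allpairs_dep.
transitivity (\sum_(t <- [seq (x.1, y.1, y.2) | x <- word_fact w, y <- word_fact x.2]) G t);
  last by rewrite big_allpairs_dep.
apply/perm_big/uniq_perm.
- apply: allpairs_uniq_dep => [|x _|]; rewrite ?word_fact_uniq //.
  move=> [[x1 x2] [y1 y2]] [[x1' x2'] [y1' y2']] /mem_st hy /mem_st hy' /= [e1 e2 e3].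
  move: hy hy'; rewrite /= !mem_word_fact e1 e2 e3 => /andP [_ /eqP <-] /andP [_ /eqP <-].
  by [].
- apply: allpairs_uniq_dep => [|x _|]; rewrite ?word_fact_uniq //.
  move=> [[x1 x2] [y1 y2]] [[x1' x2'] [y1' y2']] /mem_st hy /mem_st hy' /= [e1 e2 e3].
  move: hy hy'; rewrite /= !mem_word_fact e1 e2 e3 => /andP [_ /eqP <-] /andP [_ /eqP <-].
  by [].
move=> [[u v] z]; apply/allpairsPdep/allpairsPdep.
  case=> [[a b] [[c d] [/= h1 h2 [-> -> ->]]]].
  move: h1 h2; rewrite !mem_word_fact => /andP [/eqP s1 /eqP e1] /andP [/eqP s2 /eqP e2].
  exists (c, nabla_word d b), (d, b); rewrite !mem_word_fact /=; split=> //.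
    by rewrite size_nabla_word s2 -nabla_assoc ?e2 ?e1 ?eqxx // s1 -e2 inputs_nabla_word.
  by rewrite eqxx andbT s1 -e2 inputs_nabla_word.
case=> [[a b] [[c d] [/= h1 h2 [-> -> ->]]]].
move: h1 h2; rewrite !mem_word_fact => /andP [/eqP s1 /eqP e1] /andP [/eqP s2 /eqP e2].
have sc : size c = inputs arity a by rewrite -s1 -e2 size_nabla_word.
exists (nabla_word a c, d), (a, c); rewrite !mem_word_fact /=; split=> //.
  by rewrite inputs_nabla_word // s2 eqxx nabla_assoc ?e2 ?e1 ?eqxx.
by rewrite sc !eqxx.
Qed.
Lemma word_fact_props w x : x \in word_fact w ->
  [/\ size x.1 = size w, inputs arity x.1 = size x.2, inputs arity x.2 = inputs arity w
    & nabla_word x.1 x.2 = w].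
Proof.
case: x => u v; rewrite mem_word_fact => /andP [/eqP s /eqP <-] /=.
by rewrite size_nabla_word inputs_nabla_word.
Qed.

Lemma all_ncempty_nseq w : all (pred1 ncempty) w -> w = nseq (size w) ncempty.
Proof. by move/all_pred1P. Qed.

Lemma inputs_size_eq w : size w = inputs arity w -> w = nseq (size w) ncempty.
Proof.
elim: w => // p w IH; rewrite inputs_cons /= => e.
have arith (s i k : nat) : (s <= i)%N -> s.+1 = (k.+1 + i)%N -> k = 0%N /\ s = i by lia.
have [e1 e2] := arith _ _ _ (size_inputs w) e.
rewrite -IH //; congr cons; apply: code_nil; apply: size0nil; by rewrite size_code.
Qed.

(** A word with more inputs than letters has exactly one factorization whose
   first factor is a unit, and one whose second factor is a unit. *)
Lemma sum_word_fact_red (V : nmodType) (F : seq ncpart * seq ncpart -> V) n m w :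
  n != m -> size w = n -> inputs arity w = m ->
  \sum_(x <- word_fact w) F x =
  F (nseq n ncempty, w) + (F (w, nseq m ncempty) +
    \sum_(x <- word_fact w | (size x.2 != n) && (size x.2 != m)) F x).
Proof.
move=> ne sw iw; pose l := (nseq n ncempty, w); pose r := (w, nseq m ncempty).
have ll : l \in word_fact w.
  by rewrite mem_word_fact; apply/andP; rewrite inputs_nseq (nabla_nseq sw) sw.
have rr : r \in word_fact w.
  by rewrite mem_word_fact; apply/andP; rewrite size_nseq -iw nabla_word_nseq.
have lr : r != l.
  by apply: contra ne => /eqP /(congr1 snd) /= e; rewrite -sw -e size_nseq.
have el x : x \in word_fact w -> (size x.2 == n) = (x == l).
  move=> /word_fact_props [sx ix1 ix2 ex]; apply/eqP/eqP => [e|->]; last exact: sw.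
  have e1 : x.1 = nseq n ncempty.
    by rewrite -sw -sx; apply: inputs_size_eq; rewrite sx ix1 e.
  by rewrite [x]surjective_pairing /l -[in RHS]ex e1 nabla_nseq.
have er x : x \in word_fact w -> (size x.2 == m) = (x == r).
  move=> /word_fact_props [sx ix1 ix2 ex]; apply/eqP/eqP => [e|->]; last exact: size_nseq.
  have e2 : x.2 = nseq m ncempty by rewrite -e; apply: inputs_size_eq; rewrite ix2 iw.
  have e1 : x.1 = w by rewrite -[in RHS]ex e2 -e -ix1 nabla_word_nseq.
  by rewrite [x]surjective_pairing e1 e2.
rewrite (bigD1_seq l) ?word_fact_uniq //= -big_filter; congr (_ + _).
rewrite (bigD1_seq r) ?filter_uniq ?word_fact_uniq //=; last by rewrite mem_filter lr.
rewrite big_filter_cond; congr (_ + _).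
rewrite big_seq_cond [RHS]big_seq_cond; apply: eq_bigl => x.
by case: (boolP (x \in word_fact w)) => //= h; rewrite el // er.
Qed.
End WordFactSums.

Local Open Scope ring_scope.

(** * Linear maps on tensor products of bicollections *)

Section Spanned.
Variable K : fieldType.

(** The vectors satisfying [S] span [V], as an induction principle. *)
Definition spanned (V : lmodType K) (S : V -> Prop) : Prop :=
  forall P : V -> Prop, P 0 -> (forall a x y, P x -> P y -> P (a *: x + y)) ->
  (forall x, S x -> P x) -> forall x, P x.

Lemma spanned_ext (V U : lmodType K) (S : V -> Prop) (f g : {linear V -> U}) :
  spanned S -> (forall x, S x -> f x = g x) -> f =1 g.
Proof.
by move=> spS fg; apply: spS => // [|a x y fx fy]; rewrite ?linear0 // !linearP fx fy.
Qed.

Implicit Types P Q : bicoll K.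

Lemma hom_ext P Q (SP : forall n m, P n m -> Prop) (f g : hom P Q) :
  (forall n m, spanned (@SP n m)) -> (forall n m x, SP n m x -> f n m x = g n m x) ->
  eqhom f g.
Proof. by move=> spP fg n m; apply: spanned_ext (spP n m) (fg n m). Qed.

(** The pure tensors of vectors satisfying [SP] and [SQ]. *)
Inductive hpures P Q (SP : forall n m, P n m -> Prop) (SQ : forall n m, Q n m -> Prop)
    n m : htens P Q n m -> Prop :=
  HPures n1 m1 n2 m2 (en : (n1 + n2)%N = n) (em : (m1 + m2)%N = m)
    (p : P n1 m1) (q : Q n2 m2) : SP _ _ p -> SQ _ _ q -> hpures SP SQ (hpure en em p q).

(** The vertical analogue of [hpures]. *)
Inductive vpures P Q (SP : forall n m, P n m -> Prop) (SQ : forall n m, Q n m -> Prop)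
    n m : vtens P Q n m -> Prop :=
  VPures k (p : P n k) (q : Q k m) : SP _ _ p -> SQ _ _ q -> vpures SP SQ (vpure p q).

Lemma dpure0l (I : choiceType) (V W : I -> lmodType K) i (w : W i) : dpure i (0 : V i) w = 0.
Proof.
by have := dpurel (-1) (0 : V i) 0 w; rewrite scaler0 addr0 scaleN1r addNr.
Qed.
Lemma dpure0r (I : choiceType) (V W : I -> lmodType K) i (v : V i) : dpure i v (0 : W i) = 0.
Proof.
by have := dpurer (-1) v (0 : W i) 0; rewrite scaler0 addr0 scaleN1r addNr.
Qed.

Lemma dsum_spanned (I : choiceType) (V W : I -> lmodType K)
    (SV : forall i, V i -> Prop) (SW : forall i, W i -> Prop) (S : dsum V W -> Prop) :
  (forall i, spanned (SV i)) -> (forall i, spanned (SW i)) ->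
  (forall i v w, SV i v -> SW i w -> S (dpure i v w)) -> spanned S.
Proof.
move=> spV spW SS P P0 PD PS; apply: dsum_ind => // [x y Px Py|i v w].
  by rewrite -[x]scale1r; apply: PD.
apply: (spV i (fun v => P (dpure i v w))) => [|a v1 v2 P1 P2|{}v Sv].
- by rewrite dpure0l.
- by rewrite dpurel; apply: PD.
apply: (spW i (fun w => P (dpure i v w))) => [|a w1 w2 P1 P2|{}w Sw].
- by rewrite dpure0r.
- by rewrite dpurer; apply: PD.
by apply/PS/SS.
Qed.

Lemma dpure_hpure P Q n1 m1 n2 m2 n m h (p : P n1 m1) (q : Q n2 m2) :
  dpure (exist _ ((n1, m1), (n2, m2)) h : hidx n m) p q =
  hpure (hidx_n (exist _ ((n1, m1), (n2, m2)) h : hidx n m))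
        (hidx_m (exist _ ((n1, m1), (n2, m2)) h : hidx n m)) p q.
Proof. by rewrite /hpure; case: _ / (eq_irrelevance h (hidxP _ _)). Qed.

Lemma htens_spanned P Q (SP : forall n m, P n m -> Prop) (SQ : forall n m, Q n m -> Prop) :
  (forall n m, spanned (SP n m)) -> (forall n m, spanned (SQ n m)) ->
  forall n m, spanned (@hpures P Q SP SQ n m).
Proof.
move=> spP spQ n m; apply: (dsum_spanned (SV := fun x : hidx n m => SP _ _)
  (SW := fun x : hidx n m => SQ _ _)) => // x p q Sp Sq.
case: x p q Sp Sq => [[[n1 m1] [n2 m2]] h] p q Sp Sq.
by rewrite dpure_hpure; apply: HPures.
Qed.

Lemma vtens_spanned P Q (SP : forall n m, P n m -> Prop) (SQ : forall n m, Q n m -> Prop) :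
  (forall n m, spanned (SP n m)) -> (forall n m, spanned (SQ n m)) ->
  forall n m, spanned (@vpures P Q SP SQ n m).
Proof.
move=> spP spQ n m; apply: (dsum_spanned (SV := fun k => SP n k)
  (SW := fun k => SQ k m)) => //.
Qed.

Lemma vtens_ind P Q n m (S : vtens P Q n m -> Prop) : S 0 ->
  (forall x y, S x -> S y -> S (x + y)) ->
  (forall k (p : P n k) (q : Q k m), S (vpure p q)) -> forall x, S x.
Proof. exact: dsum_ind. Qed.

Lemma vpure0l P Q n k m (q : Q k m) : vpure (0 : P n k) q = 0.
Proof. exact: dpure0l. Qed.
Lemma vpure0r P Q n k m (p : P n k) : vpure p (0 : Q k m) = 0.
Proof. exact: dpure0r. Qed.
Lemma vpureZl P Q n k m a (p : P n k) (q : Q k m) : vpure (a *: p) q = a *: vpure p q.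
Proof. by have := vpurel a p 0 q; rewrite vpure0l !addr0. Qed.
Lemma vpureZr P Q n k m a (p : P n k) (q : Q k m) : vpure p (a *: q) = a *: vpure p q.
Proof. by have := vpurer a p q 0; rewrite vpure0r !addr0. Qed.

Lemma vpureDl P Q n k m (p p' : P n k) (q : Q k m) :
  vpure (p + p') q = vpure p q + vpure p' q.
Proof. by rewrite -{1}[p]scale1r vpurel scale1r. Qed.

Lemma vpure_suml P Q n k m (I : Type) (s : seq I) (F : I -> P n k) (q : Q k m) :
  vpure (\sum_(i <- s) F i) q = \sum_(i <- s) vpure (F i) q.
Proof.
elim: s => [|i s IH]; first by rewrite !big_nil vpure0l.
by rewrite !big_cons -IH -[F i]scale1r vpurel !scale1r.
Qed.
Lemma vpure_sumr P Q n k m (I : Type) (s : seq I) (F : I -> Q k m) (p : P n k) :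
  vpure p (\sum_(i <- s) F i) = \sum_(i <- s) vpure p (F i).
Proof.
elim: s => [|i s IH]; first by rewrite !big_nil vpure0r.
by rewrite !big_cons -IH -[F i]scale1r vpurer !scale1r.
Qed.

Lemma hpure0l P Q n1 m1 n2 m2 n m (en : (n1 + n2)%N = n) (em : (m1 + m2)%N = m)
  (q : Q n2 m2) : hpure en em (0 : P n1 m1) q = 0.
Proof. exact: dpure0l. Qed.
Lemma hpure0r P Q n1 m1 n2 m2 n m (en : (n1 + n2)%N = n) (em : (m1 + m2)%N = m)
  (p : P n1 m1) : hpure en em p (0 : Q n2 m2) = 0.
Proof. exact: dpure0r. Qed.
Lemma hpureZl P Q n1 m1 n2 m2 n m (en : (n1 + n2)%N = n) (em : (m1 + m2)%N = m)
  a (p : P n1 m1) (q : Q n2 m2) : hpure en em (a *: p) q = a *: hpure en em p q.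
Proof. by have := hpurel en em a p 0 q; rewrite hpure0l !addr0. Qed.
Lemma hpureZr P Q n1 m1 n2 m2 n m (en : (n1 + n2)%N = n) (em : (m1 + m2)%N = m)
  a (p : P n1 m1) (q : Q n2 m2) : hpure en em p (a *: q) = a *: hpure en em p q.
Proof. by have := hpurer en em a p q 0; rewrite hpure0r !addr0. Qed.
Lemma hpure_suml P Q n1 m1 n2 m2 n m (en : (n1 + n2)%N = n) (em : (m1 + m2)%N = m)
    (I : Type) (s : seq I) (F : I -> P n1 m1) (q : Q n2 m2) :
  hpure en em (\sum_(i <- s) F i) q = \sum_(i <- s) hpure en em (F i) q.
Proof.
elim: s => [|i s IH]; first by rewrite !big_nil hpure0l.
by rewrite !big_cons -IH -[F i]scale1r hpurel !scale1r.
Qed.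
Lemma hpure_sumr P Q n1 m1 n2 m2 n m (en : (n1 + n2)%N = n) (em : (m1 + m2)%N = m)
    (I : Type) (s : seq I) (F : I -> Q n2 m2) (p : P n1 m1) :
  hpure en em p (\sum_(i <- s) F i) = \sum_(i <- s) hpure en em p (F i).
Proof.
elim: s => [|i s IH]; first by rewrite !big_nil hpure0r.
by rewrite !big_cons -IH -[F i]scale1r hpurer !scale1r.
Qed.

Lemma vmapE P P' Q Q' (f : hom P P') (g : hom Q Q') n k m (p : P n k) (q : Q k m) :
  vmap f g n m (vpure p q) = vpure (f n k p) (g k m q).
Proof. by rewrite /vmap {1}/vpure dliftE. Qed.

Lemma hmapE P P' Q Q' (f : hom P P') (g : hom Q Q') n1 m1 n2 m2 n m
    (en : (n1 + n2)%N = n) (em : (m1 + m2)%N = m) (p : P n1 m1) (q : Q n2 m2) :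
  hmap f g n m (hpure en em p q) = hpure en em (f _ _ p) (g _ _ q).
Proof. by rewrite /hmap {1}/hpure dliftE /=; apply: hpure_irr. Qed.

(** * The units of the two tensor products *)

Lemma tot_const1 : tot (const_mx 1 : 'rV[K]_true) = 1.
Proof. by rewrite /tot big_ord1 mxE. Qed.

Lemma const1_false (b : bool) : b = false -> (const_mx 1 : 'rV[K]_b) = 0.
Proof. by move=> ->; apply: thinmx0. Qed.

Lemma const1_spanned (b : bool) : spanned (fun x : 'rV[K]_b => x = const_mx 1).
Proof.
move=> P P0 PD P1 x; case: b P P0 PD P1 x => P P0 PD P1 x; last by rewrite thinmx0.
suff -> : x = x 0 0 *: const_mx 1 + 0 by apply: PD => //; apply: P1.
by apply/rowP => i; rewrite !mxE mulr1 addr0 !ord1.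
Qed.

(** The generators of the vertical and the horizontal unit. *)
Inductive is_vone : forall n m, vunit K n m -> Prop := IsVone n : is_vone (vone1 K n).

Lemma vunit_spanned n m : spanned (@is_vone n m).
Proof.
move=> P P0 PD P1; apply: const1_spanned => // _ ->.
have [e|ne] : n = m \/ (n == m) = false by case: eqVneq; [left|right].
  by subst m; apply: P1; apply: IsVone.
by have -> : (const_mx 1 : vunit K n m) = 0 by apply: const1_false.
Qed.

Inductive is_hone : forall n m, hunit K n m -> Prop := IsHone : is_hone (hone1 K).

Lemma hunit_spanned n m : spanned (@is_hone n m).
Proof.
move=> P P0 PD P1; apply: const1_spanned => // _ ->.
case: n m P P0 PD P1 => [|n] [|m] P P0 PD P1; first by apply: P1; apply: IsHone.
- by have -> : (const_mx 1 : hunit K 0 m.+1) = 0 by apply: const1_false.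
- by have -> : (const_mx 1 : hunit K n.+1 0) = 0 by apply: const1_false.
- by have -> : (const_mx 1 : hunit K n.+1 m.+1) = 0 by apply: const1_false.
Qed.

Lemma hunit_mapE P (e : P 0%N 0%N) : hunit_map e 0%N 0%N (hone1 K) = e.
Proof. by rewrite /hunit_map /= /scale_tot tot_const1 scale1r. Qed.

Lemma vunit_mapE P (e : forall n, P n n) n : vunit_map e n n (vone1 K n) = e n.
Proof.
rewrite /vunit_map /= /scale_tot /vone1 /vunit_val.
have -> : tot (const_mx 1 : 'rV[K]_(n == n)) = 1 by rewrite eqxx tot_const1.
by case: eqP => // E; rewrite scale1r eq_axiomK.
Qed.
End Spanned.

(** * Monoids, comonoids and morphisms, checked on spanning sets *)

Section Criteria.
Variable K : fieldType.

Lemma is_halgI (A : halg K) (SA : forall n m, A n m -> Prop) :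
  (forall n m, spanned (@SA n m)) ->
  (forall n1 m1 n2 m2 n3 m3 n m n12 m12 n23 m23
      (en12 : (n1 + n2)%N = n12) (em12 : (m1 + m2)%N = m12)
      (en23 : (n2 + n3)%N = n23) (em23 : (m2 + m3)%N = m23)
      (en : (n12 + n3)%N = n) (em : (m12 + m3)%N = m)
      (en' : (n1 + n23)%N = n) (em' : (m1 + m23)%N = m) p q s,
    SA n1 m1 p -> SA n2 m2 q -> SA n3 m3 s ->
    hmul A n m (hpure en em (hmul A n12 m12 (hpure en12 em12 p q)) s) =
    hmul A n m (hpure en' em' p (hmul A n23 m23 (hpure en23 em23 q s)))) ->
  (forall n m p, SA n m p ->
    hmul A n m (hpure (add0n n) (add0n m) (hone A 0%N 0%N (hone1 K)) p) = p /\
    hmul A n m (hpure (addn0 n) (addn0 m) p (hone A 0%N 0%N (hone1 K))) = p) ->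
  is_halg A.
Proof.
move=> sp HA H1; split.
- apply: (hom_ext (htens_spanned (htens_spanned sp sp) sp)) => n m t.
  case=> n12 m12 n3 m3 en em p q [n1 m1 n2 m2 en12 em12 x y Sx Sy] Sq.
  have en' : (n1 + (n2 + n3))%N = n by rewrite addnA en12.
  have em' : (m1 + (m2 + m3))%N = m by rewrite addnA em12.
  rewrite /comphom /= hmapE (hassocE _ _ _ _ en' em' erefl erefl) hmapE /=.
  exact: HA.
- apply: (hom_ext sp) => n m x Sx;
  change (hmul A n m (hmap (hone A) (idhom A) n m (hpure (add0n n) (add0n m) (hone1 K) x)) = x);
  rewrite hmapE.
  exact: (proj1 (H1 _ _ _ Sx)).
- apply: (hom_ext sp) => n m x Sx;
  change (hmul A n m (hmap (idhom A) (hone A) n m (hpure (addn0 n) (addn0 m) x (hone1 K))) = x);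
  rewrite hmapE.
  exact: (proj2 (H1 _ _ _ Sx)).
Qed.

Lemma is_halg_homI (A B : halg K) (f : hom A B) (SA : forall n m, A n m -> Prop) :
  (forall n m, spanned (@SA n m)) ->
  (forall n1 m1 n2 m2 n m (en : (n1 + n2)%N = n) (em : (m1 + m2)%N = m) p q,
    SA n1 m1 p -> SA n2 m2 q ->
    f n m (hmul A n m (hpure en em p q)) = hmul B n m (hpure en em (f _ _ p) (f _ _ q))) ->
  f 0%N 0%N (hone A 0%N 0%N (hone1 K)) = hone B 0%N 0%N (hone1 K) ->
  is_halg_hom f.
Proof.
move=> sp HA H1; split.
  apply: (hom_ext (htens_spanned sp sp)) => n m x [n1 m1 n2 m2 en em p q Sp Sq].
  by rewrite /comphom /= hmapE; apply: HA.
by apply: (hom_ext (@hunit_spanned K)) => n m x [].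
Qed.

Lemma is_vmonoidI (A : bicoll K) (nab : hom (vtens A A) A) (eta : hom (vunit K) A)
    (SA : forall n m, A n m -> Prop) :
  (forall n m, spanned (@SA n m)) ->
  (forall n l k m p q s, SA n l p -> SA l k q -> SA k m s ->
    nab n m (vpure (nab n k (vpure p q)) s) = nab n m (vpure p (nab l m (vpure q s)))) ->
  (forall n m p, SA n m p ->
    nab n m (vpure (eta n n (vone1 K n)) p) = p /\
    nab n m (vpure p (eta m m (vone1 K m))) = p) ->
  is_monoid (D := vtensor K) nab eta.
Proof.
move=> sp HA H1; split.
- apply: (hom_ext (vtens_spanned (vtens_spanned sp sp) sp)) => n m t.
  case=> k p q [l x y Sx Sy] Sq.
  by rewrite /comphom /= vmapE vassocE vmapE /=; apply: HA.
- apply: (hom_ext sp) => n m x Sx;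
  change (nab n m (vmap eta (idhom A) n m (vpure (vone1 K n) x)) = x);
  rewrite vmapE.
  exact: (proj1 (H1 _ _ _ Sx)).
- apply: (hom_ext sp) => n m x Sx;
  change (nab n m (vmap (idhom A) eta n m (vpure x (vone1 K m))) = x);
  rewrite vmapE.
  exact: (proj2 (H1 _ _ _ Sx)).
Qed.

Lemma is_vcomonoidI (A : bicoll K) (cop : hom A (vtens A A)) (cou : hom A (vunit K))
    (SA : forall n m, A n m -> Prop) :
  (forall n m, spanned (@SA n m)) ->
  (forall n m p, SA n m p ->
    vassoc A A A n m (vmap cop (idhom A) n m (cop n m p)) =
    vmap (idhom A) cop n m (cop n m p)) ->
  (forall n m p, SA n m p ->
    vmap cou (idhom A) n m (cop n m p) = vpure (vone1 K n) p /\
    vmap (idhom A) cou n m (cop n m p) = vpure p (vone1 K m)) ->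
  is_comonoid (D := vtensor K) cop cou.
Proof.
move=> sp HA H1; split; apply: (hom_ext sp) => n m x Sx; first exact: HA.
  exact: (proj1 (H1 _ _ _ Sx)).
exact: (proj2 (H1 _ _ _ Sx)).
Qed.

Lemma vprod_mulE (A B : halg K) n1 k1 m1 n2 k2 m2 n m
    (en : (n1 + n2)%N = n) (em : (m1 + m2)%N = m)
    (p1 : A n1 k1) (p2 : B k1 m1) (p3 : A n2 k2) (p4 : B k2 m2) :
  hmul (vprod_halg A B) n m (hpure (P := vprod_halg A B) (Q := vprod_halg A B)
    en em (vpure p1 p2) (vpure p3 p4)) =
  vpure (hmul A n (k1 + k2)%N (hpure en erefl p1 p3))
        (hmul B (k1 + k2)%N m (hpure erefl em p2 p4)).
Proof. by rewrite /vprod_halg /= exchangeE vmapE. Qed.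

Lemma vprod_oneE (A B : halg K) :
  hone (vprod_halg A B) 0%N 0%N (hone1 K) =
  vpure (hone A 0%N 0%N (hone1 K)) (hone B 0%N 0%N (hone1 K)).
Proof. by rewrite /vprod_halg /= hunit_mapE vmapE. Qed.

Lemma vunit_mulE n1 n2 n (e e' : (n1 + n2)%N = n) :
  hmul (vunit_halg K) n n (hpure (P := vunit_halg K) (Q := vunit_halg K)
    e e' (vone1 K n1) (vone1 K n2)) = vone1 K n.
Proof.
rewrite /vunit_halg /= {1}/hpure dliftE /=.
have t k : tot (vone1 K k) = 1 by rewrite /vone1 eqxx tot_const1.
by rewrite !t mulr1 scale1r.
Qed.
End Criteria.

(** * Convolution *)

Section Convolution.
Variables (K : fieldType) (A : bicoll K).
Variables (cop : hom A (vtens A A)) (nab : hom (vtens A A) A).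
Variables (cou : hom A (vunit K)) (eta : hom (vunit K) A).
Hypotheses (nabM : is_monoid (D := vtensor K) nab eta).
Hypotheses (copM : is_comonoid (D := vtensor K) cop cou).
Implicit Types f g h : hom A A.

(** The convolution product of endomorphisms of [A]. *)
Definition conv f g : hom A A := comphom nab (comphom (vmap f g) cop).

Lemma vmap_comp (P P' P'' Q Q' Q'' : bicoll K) (f : hom P P') (f' : hom P' P'')
    (g : hom Q Q') (g' : hom Q' Q'') n m x :
  vmap (comphom f' f) (comphom g' g) n m x = vmap f' g' n m (vmap f g n m x).
Proof.
elim/vtens_ind: x => [|x y Ex Ey|k p q]; first by rewrite !linear0.
  by rewrite !linearD Ex Ey.
by rewrite !vmapE.
Qed.

Lemma eq_vmap (P P' Q Q' : bicoll K) (f f' : hom P P') (g g' : hom Q Q') :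
  eqhom f f' -> eqhom g g' -> eqhom (vmap f g) (vmap f' g').
Proof.
move=> ef eg n m; elim/vtens_ind => [|x y Ex Ey|k p q]; first by rewrite !linear0.
  by rewrite !linearD Ex Ey.
by rewrite !vmapE ef eg.
Qed.

Lemma vassoc_nat (P P' Q Q' S S' : bicoll K) (f : hom P P') (g : hom Q Q')
    (h : hom S S') n m x :
  vassoc P' Q' S' n m (vmap (vmap f g) h n m x) =
  vmap f (vmap g h) n m (vassoc P Q S n m x).
Proof.
elim/vtens_ind: x => [|x y Ex Ey|k t s]; first by rewrite !linear0.
  by rewrite !linearD Ex Ey.
elim/vtens_ind: t => [|x y Ex Ey|l p q].
- by rewrite vpure0l !linear0.
- rewrite vpureDl.
  rewrite (linearD (vmap (vmap f g) h n m)).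
  rewrite (linearD (vassoc P' Q' S' n m)).
  rewrite (linearD (vassoc P Q S n m)).
  rewrite [RHS](linearD (vmap f (vmap g h) n m)).
  exact: (f_equal2 +%R Ex Ey).
- by rewrite !vmapE !vassocE !vmapE.
Qed.

Lemma convA f g h : eqhom (conv (conv f g) h) (conv f (conv g h)).
Proof.
case: nabM copM => [nA _ _] [cA _ _] n m c; rewrite /conv /=.
have e1 := vmap_comp (comphom (vmap f g) cop) nab h (idhom A) (cop n m c).
have -> : vmap (comphom nab (comphom (vmap f g) cop)) h n m (cop n m c) =
  vmap nab (idhom A) n m (vmap (vmap f g) h n m (vmap cop (idhom A) n m (cop n m c))).
  by rewrite -!vmap_comp; apply: eq_vmap.
have -> : vmap f (comphom nab (comphom (vmap g h) cop)) n m (cop n m c) =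
  vmap (idhom A) nab n m (vmap f (vmap g h) n m (vmap (idhom A) cop n m (cop n m c))).
  by rewrite -!vmap_comp; apply: eq_vmap.
rewrite -[vmap (idhom A) cop n m _](cA n m c) /= -vassoc_nat.
exact: nA.
Qed.

Lemma eq_conv f f' g g' : eqhom f f' -> eqhom g g' -> eqhom (conv f g) (conv f' g').
Proof. by move=> ef eg n m c; rewrite /conv /= (eq_vmap ef eg). Qed.

Lemma conv1 f : eqhom (conv (comphom eta cou) f) f.
Proof.
case: nabM copM => [_ n1 _] [_ c1 _] n m c; rewrite /conv /=.
have -> : vmap (comphom eta cou) f n m (cop n m c) =
  vmap eta f n m (vmap cou (idhom A) n m (cop n m c)).
  by rewrite -vmap_comp; apply: eq_vmap.
rewrite [vmap cou _ n m _](c1 n m c) /= /vlam_fun vmapE.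
by have := n1 n m (f n m c); rewrite /= /vlam_fun vmapE.
Qed.

Lemma conv1r f : eqhom (conv f (comphom eta cou)) f.
Proof.
case: nabM copM => [_ _ n1] [_ _ c1] n m c; rewrite /conv /=.
have -> : vmap f (comphom eta cou) n m (cop n m c) =
  vmap f eta n m (vmap (idhom A) cou n m (cop n m c)).
  by rewrite -vmap_comp; apply: eq_vmap.
rewrite [vmap _ cou n m _](c1 n m c) /= /vrho_fun vmapE.
by have := n1 n m (f n m c); rewrite /= /vrho_fun vmapE.
Qed.

(** A right convolution inverse [S] of the identity is also a left inverse when
   [A] is triangular with trivial diagonal: [E = S * id - eta eps] satisfies
   [id * E = 0], hence [E = - (id - eta eps) * E]. In bidegree [(n, m)] the right
   hand side involves [E] only in bidegrees [(k, m)] with [n < k], so [E] vanishes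
   by induction on [m - n]. *)
Lemma conv_left_antipode (S : hom A A) :
  (forall n m (c : A n m), (m < n)%N -> c = 0) ->
  (forall n (c : A n n), eta n n (cou n n c) = c) ->
  eqhom (conv (idhom A) S) (comphom eta cou) ->
  eqhom (conv S (idhom A)) (comphom eta cou).
Proof.
move=> A0 A1 SR.
have eL : eqhom (conv (idhom A) (conv S (idhom A))) (idhom A).
  by move=> n m c; rewrite -convA (eq_conv SR (fun _ _ _ => erefl)) conv1.
suff H r n m c : (m < n + r)%N -> conv S (idhom A) n m c = comphom eta cou n m c.
  by move=> n m c; apply: (H m.+1); rewrite addnS ltnS leq_addl.
elim: r n m c => [|r IH] n m c lt.
  by rewrite (A0 _ _ c) ?linear0 // -(addn0 n).
set f := conv S (idhom A) in IH eL *; set g := comphom eta cou in IH *.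
(* The component (n, k) of id - eta eps vanishes unless n < k, where the
   induction hypothesis applies. *)
have key t : vmap (idhom A) f n m t - vmap (idhom A) g n m t =
             vmap g f n m t - vmap g g n m t.
  elim/vtens_ind: t => [|x y Ex Ey|k p q]; first by rewrite !linear0.
    by rewrite !linearD [LHS]addrACA [RHS]addrACA; exact: (f_equal2 +%R Ex Ey).
  rewrite !vmapE; case: (ltngtP n k) => [nk|kn|e].
  - by rewrite IH ?subrr //; apply: leq_trans lt _; rewrite addnS -addSn leq_add2r.
  - by rewrite (A0 _ _ p kn) !linear0 !vpure0l.
  - by subst k; rewrite /g /= A1.
have e1 : nab n m (vmap (idhom A) f n m (cop n m c)) = c := eL n m c.
have e2 : nab n m (vmap (idhom A) g n m (cop n m c)) = c := conv1r (idhom A) c.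
have e3 : nab n m (vmap g f n m (cop n m c)) = f n m c := conv1 f c.
have e4 : nab n m (vmap g g n m (cop n m c)) = g n m c := conv1 g c.
have e5 := etrans (esym (linearB (nab n m) _ _))
  (etrans (congr1 (nab n m) (key (cop n m c))) (linearB (nab n m) _ _)).
have eq4 (V : zmodType) (a b x y d s t : V) :
    a - b = x - y -> a = d -> b = d -> x = s -> y = t -> s = t.
  by move=> e ea eb <- <-; move: e; rewrite ea eb subrr => /esym /subr0_eq.
exact: (eq4 _ _ _ _ _ _ _ _ e5 e1 e2 e3 e4).
Qed.
End Convolution.

(** * Horizontal algebras of words *)

Section Words.
Variables (K : fieldType) (B : choiceType) (ar : B -> nat).
Notation W := (words_halg K ar).

(** The basis element of [words K ar n m] given by the sequence [w], and [0] if
   [w] is not a word with [n] letters and [m] inputs. *)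
Definition wordv n m (w : seq B) : W n m :=
  if insub w is Some w' then << (w' : word ar n m) >> else 0.

Lemma wordvE n m w (en : size w = n) (em : inputs ar w = m) :
  wordv n m w = << mkword en em >>.
Proof.
rewrite /wordv; case: insubP => [w' _ e|]; last by rewrite en em !eqxx.
by congr (<< _ >>); apply: val_inj.
Qed.

Lemma wordv_val n m (w : word ar n m) : wordv n m (val w) = << w >>.
Proof. by rewrite (wordvE (word_n w) (word_m w)); congr (<< _ >>); apply: val_inj. Qed.

(* Opacity only keeps unification from unfolding basis vectors. *)
Opaque wordv.

(** The basis of words. *)
Inductive is_word n m : W n m -> Prop :=
  IsWord w : size w = n -> inputs ar w = m -> is_word (wordv n m w).

Lemma malg_spanned (T : choiceType) :
  spanned (fun x : {malg K[T]} => exists b, x = << b >>).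
Proof.
move=> P P0 PD PS x; rewrite (monalgE x).
elim: (X in \sum_(k <- X) _) => [|k r IH]; first by rewrite big_nil.
rewrite big_cons.
suff -> : << x@_k *g k >> = x@_k *: << k >> :> {malg K[T]} by apply: PD => //; apply: PS; exists k.
by apply/malgP => c; rewrite mcoeffZ !mcoeffU mulr_natr.
Qed.

Lemma words_spanned n m : spanned (@is_word n m).
Proof.
move=> P P0 PD PS; apply: malg_spanned => // _ [w ->].
by rewrite -wordv_val; apply: PS; apply: IsWord; rewrite ?word_n ?word_m.
Qed.

Lemma words_mulE n1 m1 n2 m2 n m (en : (n1 + n2)%N = n) (em : (m1 + m2)%N = m) u v :
  size u = n1 -> inputs ar u = m1 -> size v = n2 -> inputs ar v = m2 ->
  hmul W n m (hpure en em (wordv n1 m1 u) (wordv n2 m2 v)) = wordv n m (u ++ v).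
Proof.
move=> su iu sv iv; rewrite (wordvE su iu) (wordvE sv iv) /= /hpure dliftE /= lin_ext2U.
by rewrite -wordv_val.
Qed.

Lemma words_oneE : hone W 0%N 0%N (hone1 K) = wordv 0 0 [::].
Proof. by rewrite (wordvE (erefl : size [::] = 0%N) erefl) /= hunit_mapE. Qed.

Lemma words_is_halg : is_halg W.
Proof.
apply: (is_halgI words_spanned).
  move=> n1 m1 n2 m2 n3 m3 n m n12 m12 n23 m23 en12 em12 en23 em23 en em en' em' p q s.
  case=> u su iu [v sv iv] [w sw iw].
  rewrite (words_mulE _ _ su iu sv iv) (words_mulE _ _ sv iv sw iw).
  have suv : size (u ++ v) = n12 by rewrite size_cat su sv.
  have iuv : inputs ar (u ++ v) = m12 by rewrite inputs_cat iu iv.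
  have svw : size (v ++ w) = n23 by rewrite size_cat sv sw.
  have ivw : inputs ar (v ++ w) = m23 by rewrite inputs_cat iv iw.
  transitivity (wordv n m ((u ++ v) ++ w)); first exact: words_mulE.
  by rewrite -catA; symmetry; apply: words_mulE.
move=> n m p [u su iu]; rewrite words_oneE; split.
  exact: (words_mulE (add0n n) (add0n m) (u := [::])).
by rewrite (words_mulE (addn0 n) (addn0 m) (v := [::])) ?cats0.
Qed.

Section Extension.
Variables (A : halg K) (f : forall b, A 1%N (ar b)).

Lemma words_extE n m w (en : size w = n) (em : inputs ar w = m) :
  words_ext f n m (wordv n m w) = wext f en em.
Proof.
rewrite (wordvE en em) /= lin_extU /=.
by congr wext; apply: eq_irrelevance.
Qed.

Lemma words_ext_nil : words_ext f 0%N 0%N (wordv 0 0 [::]) = hone A 0%N 0%N (hone1 K).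
Proof. exact: (words_extE (erefl : size [::] = 0%N) erefl). Qed.

Lemma words_ext_cons b w n m (en : (1 + size w)%N = n) (em : (ar b + inputs ar w)%N = m) :
  words_ext f n m (wordv n m (b :: w)) =
  hmul A n m (hpure en em (f b) (words_ext f _ _ (wordv (size w) (inputs ar w) w))).
Proof. by rewrite (@words_extE n m (b :: w) en em) (words_extE erefl erefl). Qed.
End Extension.
End Words.

(** * The structure maps in the basis of words *)

Section NCWords.
Variable K : fieldType.
Notation H := (nc_halg K).
Notation wv := (wordv K arity).

Lemma letterE p : << letter arity p >> = wv 1 (arity p) [:: p].
Proof. by rewrite (wordvE K (erefl : size [:: p] = 1%N) (letter_m arity p)). Qed.

(** The antipode is diagonal in the basis of words. *)
Lemma nc_SE n m w : size w = n -> inputs arity w = m ->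
  nc_S K n m (wv n m w) = word_sign K w *: wv n m w.
Proof.
elim: w n m => [|p w IH] n m sw iw.
  subst n m; rewrite /word_sign big_nil scale1r /nc_S.
  by rewrite (words_ext_nil (A := H)) words_oneE.
have fE : (if `[< is_interval p >] then (-1) ^+ #|` blocks p| *: << letter arity p >>
           else 0 : H 1%N (arity p)) = sign K p *: wv 1 (arity p) [:: p].
  by rewrite /sign letterE; case: ifP => _ //; rewrite scale0r.
rewrite /nc_S (words_ext_cons (A := H) _ sw iw) fE (IH _ _ erefl erefl).
rewrite hpureZl hpureZr scalerA word_sign_cons.
have h := @words_mulE K _ arity 1 (arity p) (size w) (inputs arity w) n m sw iw
  [:: p] w erefl (letter_m arity p) erefl erefl.
exact: etrans (linearZ_LR (hmul H n m) _ _) (congr1 _ h).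
Qed.

Lemma vunit_mul_totE n1 m1 n2 m2 n m (en : (n1 + n2)%N = n) (em : (m1 + m2)%N = m) p q :
  hmul (vunit_halg K) n m (hpure (P := vunit_halg K) (Q := vunit_halg K)
     (n1 := n1) (m1 := m1) (n2 := n2) (m2 := m2) en em p q) = (tot p * tot q) *: const_mx 1.
Proof. by rewrite /vunit_halg /= {1}/hpure dliftE. Qed.

Lemma tot_vone n m : n = m -> tot (const_mx 1 : vunit K n m) = 1.
Proof. by move=> ->; rewrite eqxx tot_const1. Qed.

Lemma tot_if n m (b : bool) : (b -> n = m) ->
  tot (if b then const_mx 1 else 0 : vunit K n m) = b%:R.
Proof. by case: b => h; [apply/tot_vone/h | apply: linear0]. Qed.

Lemma nc_epsE n m w : size w = n -> inputs arity w = m ->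
  nc_eps K n m (wv n m w) = if all (pred1 ncempty) w then const_mx 1 else 0.
Proof.
elim: w n m => [|p w IH] n m sw iw.
  by subst n m; rewrite /nc_eps (words_ext_nil (A := vunit_halg K)) /= hunit_mapE.
rewrite /nc_eps (words_ext_cons (A := vunit_halg K) _ sw iw) vunit_mul_totE.
rewrite [words_ext _ _ _ _](IH _ _ erefl erefl).
have t1 : tot (if p == ncempty then const_mx 1 else 0 : vunit K 1 (arity p)) =
    (p == ncempty)%:R.
  by apply: tot_if => /eqP ->.
have t2 : tot (if all (pred1 ncempty) w then const_mx 1 else 0 :
    vunit K (size w) (inputs arity w)) = (all (pred1 ncempty) w)%:R.
  by apply: tot_if => /all_ncempty_nseq wE; rewrite {2}wE inputs_nseq.
have -> : all (pred1 ncempty) (p :: w) = (p == ncempty) && all (pred1 ncempty) w by [].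
rewrite t1 t2; case: (p == ncempty); last by rewrite mul0r scale0r.
by rewrite mul1r; case: (all _ w); rewrite ?scale1r ?scale0r.
Qed.

Lemma nc_etaE n : nc_eta K n n (vone1 K n) = wv n n (nseq n ncempty).
Proof. by rewrite /nc_eta vunit_mapE -wordv_val. Qed.

Lemma nc_nablaE n k m u v : size u = n -> inputs arity u = k -> size v = k ->
  inputs arity v = m ->
  nc_nabla K n m (vpure (wv n k u) (wv k m v)) = wv n m (nabla_word u v).
Proof.
move=> su iu sv iv; rewrite (wordvE K su iu) (wordvE K sv iv) /nc_nabla /vpure dliftE.
by rewrite /= lin_ext2U -wordv_val.
Qed.

(** The vertical tensor of the two words [x.1] and [x.2]. *)
Definition wpair n m (x : seq ncpart * seq ncpart) : vtens H H n m :=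
  vpure (wv n (size x.2) x.1) (wv (size x.2) m x.2).

Lemma wpairE n k m u v : size v = k -> vpure (wv n k u) (wv k m v) = wpair n m (u, v).
Proof. by move=> <-. Qed.

Lemma wpair_mul n1 m1 n2 m2 n m (en : (n1 + n2)%N = n) (em : (m1 + m2)%N = m)
    (x y : seq ncpart * seq ncpart) :
  size x.1 = n1 -> inputs arity x.1 = size x.2 -> inputs arity x.2 = m1 ->
  size y.1 = n2 -> inputs arity y.1 = size y.2 -> inputs arity y.2 = m2 ->
  hmul (vprod_halg H H) n m
    (hpure (P := vprod_halg H H) (Q := vprod_halg H H) en em (wpair n1 m1 x) (wpair n2 m2 y)) =
  wpair n m (x.1 ++ y.1, x.2 ++ y.2).
Proof.
move=> sx1 ix1 ix2 sy1 iy1 iy2.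
rewrite /wpair vprod_mulE size_cat /=.
have h1 := words_mulE K en erefl sx1 ix1 sy1 iy1.
have h2 := words_mulE K erefl em (erefl (size x.2)) ix2 (erefl (size y.2)) iy2.
exact: (f_equal2 (@vpure K H H n (size x.2 + size y.2)%N m) h1 h2).
Qed.

Lemma nc_Delta_letter p :
  \sum_(x \in factors p)
     vpure (P := H) (Q := H) << letter arity (tag x) >> << tagged x >> =
  \sum_(x <- fact p) wpair 1 (arity p) ([:: x.1], x.2).
Proof.
rewrite (fsbig_finite _ _ (finite_factors p)) /fact big_map; apply: eq_bigr => x _ /=.
by rewrite letterE -(wordv_val K (tagged x)); apply: wpairE (word_n _).
Qed.

(** The coproduct of a word is the sum of its factorizations. *)
Lemma nc_DeltaE n m w : size w = n -> inputs arity w = m ->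
  nc_Delta K n m (wv n m w) = \sum_(x <- word_fact w) wpair n m x.
Proof.
elim: w n m => [|p w IH] n m sw iw.
  subst n m; rewrite big_seq1 /nc_Delta (words_ext_nil (A := vprod_halg H H)).
  by rewrite vprod_oneE words_oneE.
rewrite /nc_Delta (words_ext_cons (A := vprod_halg H H) _ sw iw).
rewrite nc_Delta_letter [words_ext _ _ _ _](IH _ _ erefl erefl).
rewrite big_allpairs_dep hpure_suml linear_sum big_seq [RHS]big_seq.
apply: eq_bigr => x; rewrite mem_fact => /andP [/eqP s /eqP e].
rewrite hpure_sumr linear_sum big_seq [RHS]big_seq.
apply: eq_bigr => y /word_fact_props [sy1 iy1 iy2 _].
have ie : inputs arity x.2 = arity p by rewrite -e arity_gap_ins.
have h := @wpair_mul 1 (arity p) (size w) (inputs arity w) n m sw iw ([:: x.1], x.2) y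
  erefl (etrans (letter_m arity x.1) (esym s)) ie sy1 iy1 iy2.
exact: h.
Qed.
End NCWords.

(** * The Hopf algebra of words on non-crossing partitions *)

Section NCHopf.
Variable K : fieldType.
Notation H := (nc_halg K).
Notation wv := (wordv K arity).

Let sp := @words_spanned K _ arity.

Lemma nc_S_hom : is_halg_hom (A := H) (B := H) (nc_S K).
Proof.
apply: (is_halg_homI sp) => [n1 m1 n2 m2 n m en em p q [u su iu] [v sv iv]|].
  have suv : size (u ++ v) = n by rewrite size_cat su sv.
  have iuv : inputs arity (u ++ v) = m by rewrite inputs_cat iu iv.
  have h := words_mulE K en em su iu sv iv.
  apply: (etrans (congr1 (nc_S K n m) h)); apply: (etrans (nc_SE K suv iuv)).
  rewrite (nc_SE K su iu) (nc_SE K sv iv) word_sign_cat hpureZl hpureZr scalerA.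
  by apply/esym/(etrans (linearZ_LR (hmul H n m) _ _)); exact: (congr1 _ h).
by rewrite words_oneE nc_SE // /word_sign big_nil scale1r.
Qed.

Lemma nc_eps_hom : is_halg_hom (A := H) (B := vunit_halg K) (nc_eps K).
Proof.
apply: (is_halg_homI sp) => [n1 m1 n2 m2 n m en em p q [u su iu] [v sv iv]|].
  have suv : size (u ++ v) = n by rewrite size_cat su sv.
  have iuv : inputs arity (u ++ v) = m by rewrite inputs_cat iu iv.
  have h := words_mulE K en em su iu sv iv.
  apply: (etrans (congr1 (nc_eps K n m) h)); apply: (etrans (nc_epsE K suv iuv)).
  rewrite (nc_epsE K su iu) (nc_epsE K sv iv) vunit_mul_totE.
  have ts w : all (pred1 ncempty) w -> size w = inputs arity w.
    by move=> /all_ncempty_nseq ->; rewrite inputs_nseq size_nseq.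
  rewrite !tot_if => [|/ts|/ts]; rewrite ?su ?sv ?iu ?iv //.
  rewrite all_cat; case: (all _ u); last by rewrite mul0r scale0r.
  by rewrite mul1r; case: (all _ v); rewrite ?scale1r ?scale0r.
by rewrite words_oneE nc_epsE //= hunit_mapE.
Qed.

Lemma nc_eta_hom : is_halg_hom (A := vunit_halg K) (B := H) (nc_eta K).
Proof.
apply: (@is_halg_homI K (vunit_halg K) H (nc_eta K) _ (@vunit_spanned K)) => [n1 m1 n2 m2 n m en em p q Sp Sq|].
  case: Sp en em => {n1 m1 p} n1; case: Sq => {n2 m2 q} n2 en em; subst n; subst m.
  rewrite vunit_mulE !nc_etaE nseqD; apply/esym.
  exact: (words_mulE K erefl erefl (size_nseq _ _) (inputs_nseq _) (size_nseq _ _) (inputs_nseq _)).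
by rewrite words_oneE /= hunit_mapE nc_etaE.
Qed.

Lemma nc_Delta_hom : is_halg_hom (A := H) (B := vprod_halg H H) (nc_Delta K).
Proof.
apply: (is_halg_homI sp) => [n1 m1 n2 m2 n m en em p q [u su iu] [v sv iv]|].
  have suv : size (u ++ v) = n by rewrite size_cat su sv.
  have iuv : inputs arity (u ++ v) = m by rewrite inputs_cat iu iv.
  have h := words_mulE K en em su iu sv iv.
  apply: (etrans (congr1 (nc_Delta K n m) h)); apply: (etrans (nc_DeltaE K suv iuv)).
  rewrite (nc_DeltaE K su iu) (nc_DeltaE K sv iv) sum_word_fact_cat.
  rewrite hpure_suml linear_sum big_seq [RHS]big_seq.
  apply: eq_bigr => x /word_fact_props [sx ix1 ix2 _].
  rewrite hpure_sumr linear_sum big_seq [RHS]big_seq.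
  apply: eq_bigr => y /word_fact_props [sy iy1 iy2 _].
  apply/esym; apply: wpair_mul; rewrite ?sx ?sy ?ix2 ?iy2 //.
by rewrite words_oneE nc_DeltaE // big_seq1 vprod_oneE words_oneE.
Qed.

Lemma nc_nabla_hom : is_halg_hom (A := vprod_halg H H) (B := H) (nc_nabla K).
Proof.
apply: (@is_halg_homI K (vprod_halg H H) H (nc_nabla K) _ (vtens_spanned sp sp)).
  move=> n1 m1 n2 m2 n m en em x y Sx Sy.
  case: Sx en em => {x} k1 x1 x2 [u su iu] [u' su' iu'].
  case: Sy => {y} k2 y1 y2 [v sv iv] [v' sv' iv'] en em.
  have suv : size (u ++ v) = n by rewrite size_cat su sv.
  have iuv : inputs arity (u ++ v) = (k1 + k2)%N by rewrite inputs_cat iu iv.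
  have suv' : size (u' ++ v') = (k1 + k2)%N by rewrite size_cat su' sv'.
  have iuv' : inputs arity (u' ++ v') = m by rewrite inputs_cat iu' iv'.
  rewrite (nc_nablaE K su iu su' iu') (nc_nablaE K sv iv sv' iv').
  have h1 := words_mulE K en (erefl (k1 + k2)%N) su iu sv iv.
  have h2 := words_mulE K (erefl (k1 + k2)%N) em su' iu' sv' iv'.
  have h := etrans (vprod_mulE en em (wv n1 k1 u) (wv k1 m1 u') (wv n2 k2 v) (wv k2 m2 v'))
    (f_equal2 (@vpure K H H n (k1 + k2)%N m) h1 h2).
  apply: (etrans (congr1 (nc_nabla K n m) h)).
  apply: (etrans (nc_nablaE K suv iuv suv' iuv')).
  rewrite nabla_cat; last by rewrite su' iu.
  apply/esym; apply: words_mulE; rewrite ?size_nabla_word ?inputs_nabla_word ?iu ?iv //.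
rewrite vprod_oneE !words_oneE.
exact: (@nc_nablaE K 0 0 0 [::] [::]).
Qed.

Lemma nc_vmonoid : is_monoid (D := vtensor K) (nc_nabla K) (nc_eta K).
Proof.
apply: (is_vmonoidI sp) => [n l k m p q s [u su iu] [v sv iv] [w sw iw]|n m p [u su iu]].
  rewrite (nc_nablaE K su iu sv iv) (nc_nablaE K sv iv sw iw).
  have suv : size (nabla_word u v) = n by rewrite size_nabla_word.
  have iuv : inputs arity (nabla_word u v) = k by rewrite inputs_nabla_word ?iu.
  have svw : size (nabla_word v w) = l by rewrite size_nabla_word.
  have ivw : inputs arity (nabla_word v w) = m by rewrite inputs_nabla_word ?iv.
  apply: (etrans (nc_nablaE K suv iuv sw iw)).
  rewrite nabla_assoc ?sv ?sw ?iu ?iv //.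
  exact: (esym (nc_nablaE K su iu svw ivw)).
rewrite !nc_etaE; split.
  apply: (etrans (nc_nablaE K (size_nseq _ _) (inputs_nseq _) su iu)).
  by rewrite nabla_nseq.
apply: (etrans (nc_nablaE K su iu (size_nseq _ _) (inputs_nseq _))).
by rewrite -iu nabla_word_nseq.
Qed.

Lemma nc_eps_one n : nc_eps K n n (wv n n (nseq n ncempty)) = vone1 K n.
Proof.
apply: (etrans (nc_epsE K (size_nseq _ _) (inputs_nseq _))).
by have -> : all (pred1 ncempty) (nseq n ncempty) by rewrite all_nseq /= orbT.
Qed.

(** Coassociativity and the counit laws express, on words, the associativity and
   the unit laws of [nabla_word]. *)
Lemma nc_vcomonoid : is_comonoid (D := vtensor K) (nc_Delta K) (nc_eps K).
Proof.
apply: (is_vcomonoidI sp) => n m p [w sw iw].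
  rewrite (nc_DeltaE K sw iw).
  rewrite (linear_sum (vmap (nc_Delta K) (idhom H) n m)).
  rewrite (linear_sum (vmap (idhom H) (nc_Delta K) n m)).
  rewrite (linear_sum (vassoc H H H n m)).
  pose F a b c : vtens H (vtens H H) n m :=
    vpure (wv n (size b) a) (vpure (wv (size b) (size c) b) (wv (size c) m c)).
  transitivity (\sum_(x <- word_fact w) \sum_(y <- word_fact x.1) F y.1 y.2 x.2).
    apply: eq_big_seq => x /word_fact_props [sx ix1 ix2 _].
    have sn : size x.1 = n by rewrite sx.
    rewrite vmapE (nc_DeltaE K sn ix1) vpure_suml (linear_sum (vassoc H H H n m)).
    by apply: eq_bigr => y _; apply: vassocE.
  rewrite sum_word_fact_assoc.
  apply: eq_big_seq => x /word_fact_props [sx ix1 ix2 _].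
  have im : inputs arity x.2 = m by rewrite ix2.
  rewrite vmapE (nc_DeltaE K erefl im) vpure_sumr.
  by apply: eq_big_seq => y /word_fact_props [sy _ _ _]; rewrite /F sy.
rewrite (nc_DeltaE K sw iw); subst n m; split.
  rewrite (linear_sum (vmap (nc_eps K) (idhom H) _ _)).
  rewrite (sum_uniq1 (x0 := (nseq (size w) ncempty, w)) (word_fact_uniq w)).
  - rewrite vmapE.
    exact: (congr1
      (fun z : vunit K _ _ => vpure (Q := H) z (wv (size w) (inputs arity w) w)) (nc_eps_one (size w))).
  - by rewrite mem_word_fact inputs_nseq nabla_nseq // !eqxx.
  move=> x /word_fact_props [sx ix1 ix2 ex] ne.
  rewrite vmapE (nc_epsE K sx ix1) ifN ?vpure0l //; apply: contra ne => /all_ncempty_nseq e1.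
  have e2 : size x.2 = size w by rewrite -ix1 e1 inputs_nseq sx.
  rewrite sx in e1; rewrite e1 nabla_nseq // in ex.
  by rewrite [x]surjective_pairing e1 ex.
rewrite (linear_sum (vmap (idhom H) (nc_eps K) _ _)).
rewrite (sum_uniq1 (x0 := (w, nseq (inputs arity w) ncempty)) (word_fact_uniq w)).
- rewrite vmapE size_nseq.
  exact: (congr1
    (fun z : vunit K _ _ => vpure (P := H) (wv (size w) (inputs arity w) w) z) (nc_eps_one (inputs arity w))).
- by rewrite mem_word_fact size_nseq nabla_word_nseq !eqxx.
move=> x /word_fact_props [sx ix1 ix2 ex] ne.
rewrite vmapE (nc_epsE K erefl ix2) ifN ?vpure0r //; apply: contra ne => /all_ncempty_nseq e1.
have e2 : size x.2 = inputs arity w by rewrite -ix2 [in RHS]e1 inputs_nseq.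
rewrite -ix1 in e1; rewrite e1 nabla_word_nseq in ex.
by rewrite [x]surjective_pairing e1 ix1 e2 ex.
Qed.

(** The coefficient of a word [w] in [(id * S) w]. *)
Lemma sum_word_sign_word w :
  \sum_(x <- word_fact w) word_sign K x.2 = (all (pred1 ncempty) w)%:R.
Proof.
elim: w => [|p w IH]; first by rewrite big_seq1 /word_sign big_nil.
rewrite big_allpairs_dep /=.
transitivity (\sum_(x <- fact p) word_sign K x.2 *
    \sum_(y <- word_fact w) word_sign K y.2).
  by apply: eq_bigr => x _; rewrite mulr_sumr; apply: eq_bigr => y _; rewrite -word_sign_cat.
by rewrite -mulr_suml sum_word_sign IH -natrM mulnb.
Qed.

Lemma nc_antipode_r :
  eqhom (comphom (nc_nabla K) (comphom (vmap (idhom H) (nc_S K)) (nc_Delta K)))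
        (comphom (nc_eta K) (nc_eps K)).
Proof.
apply: (hom_ext sp) => n m p [w sw iw].
change (nc_nabla K n m (vmap (idhom H) (nc_S K) n m (nc_Delta K n m (wv n m w))) =
  nc_eta K n m (nc_eps K n m (wv n m w))).
rewrite (nc_DeltaE K sw iw) (nc_epsE K sw iw).
rewrite (linear_sum (vmap (idhom H) (nc_S K) n m)) (linear_sum (nc_nabla K n m)).
transitivity ((\sum_(x <- word_fact w) word_sign K x.2) *: wv n m w).
  rewrite scaler_suml; apply: eq_big_seq => x /word_fact_props [sx ix1 ix2 ex].
  have sn : size x.1 = n by rewrite sx.
  have im : inputs arity x.2 = m by rewrite ix2.
  rewrite vmapE (nc_SE K erefl im) vpureZr.
  apply: (etrans (linearZ_LR (nc_nabla K n m) _ _)); congr (_ *: _).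
  by apply: (etrans (nc_nablaE K sn ix1 erefl im)); rewrite ex.
rewrite sum_word_sign_word; case: ifP => [/all_ncempty_nseq e|_]; last first.
  by rewrite scale0r linear0.
have nm : n = m by rewrite -sw -iw {2}e inputs_nseq.
subst m; rewrite sw in e; rewrite scale1r e. rewrite inputs_nseq; exact: (esym (nc_etaE K n)).
Qed.

Lemma nc_words0 n m (c : H n m) : (m < n)%N -> c = 0.
Proof.
move=> lt; apply: (sp (P := fun c => c = 0)) c => // [a x y -> ->|_ [w sw iw]].
  by rewrite scaler0 addr0.
by have := size_inputs w; rewrite sw iw leqNgt lt.
Qed.

Lemma nc_eta_eps n (c : H n n) : nc_eta K n n (nc_eps K n n c) = c.
Proof.
apply: (sp (P := fun c => nc_eta K n n (nc_eps K n n c) = c)) c => [|a x y ex ey|_ [w sw iw]].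
- by rewrite !linear0.
- by rewrite (linearP (nc_eps K n n)) (linearP (nc_eta K n n)) ex ey.
have e : w = nseq (size w) ncempty by apply: inputs_size_eq; rewrite sw iw.
rewrite sw in e; apply: (etrans (congr1 (nc_eta K n n) (nc_epsE K sw iw))).
have -> : all (pred1 ncempty) w by rewrite e all_nseq /= orbT.
rewrite e; exact: nc_etaE.
Qed.

Lemma nc_antipode_l :
  eqhom (comphom (nc_nabla K) (comphom (vmap (nc_S K) (idhom H)) (nc_Delta K)))
        (comphom (nc_eta K) (nc_eps K)).
Proof.
apply: (conv_left_antipode nc_vmonoid nc_vcomonoid nc_words0 nc_eta_eps).
exact: nc_antipode_r.
Qed.

Lemma nc_hopf :
  is_hopf (A := H) (nc_Delta K) (nc_nabla K) (nc_S K) (nc_eps K) (nc_eta K).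
Proof.
have HA : is_halg H := words_is_halg K arity.
split.
- exact: And4 HA nc_Delta_hom nc_eps_hom nc_vcomonoid.
- exact: And4 HA nc_nabla_hom nc_eta_hom nc_vmonoid.
- exact: nc_S_hom.
- exact: nc_antipode_l.
- exact: nc_antipode_r.
Qed.

(** * Co-nilpotency *)

Lemma in_middle0 n m : in_middle (0 : vtens H H n m).
Proof. by exists [::]; rewrite big_nil. Qed.

Lemma in_middleP n m a (x y : vtens H H n m) :
  in_middle x -> in_middle y -> in_middle (a *: x + y).
Proof.
move=> [s [/allP ms ->]] [t [mt ->]].
exists ([seq existT (fun k => (H n k * H k m)%type) (tag z)
           (a *: (tagged z).1, (tagged z).2) | z <- s] ++ t); split.
  by rewrite all_cat mt andbT all_map; apply/allP => z /ms.
rewrite big_cat big_map scaler_sumr; congr (_ + _).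
by apply: eq_bigr => z _; rewrite -vpureZl.
Qed.

(** The word of [n] empty partitions, which spans [H n n]. *)
Definition nc_one n : H n n := wv n n (nseq n ncempty).

Lemma cop_red_word n m w : n != m -> size w = n -> inputs arity w = m ->
  cop_red nc_one (nc_Delta K) n m (wv n m w) =
  \sum_(x <- word_fact w | (size x.2 != n) && (size x.2 != m)) wpair K n m x.
Proof.
move=> ne sw iw.
change (cop_red_fun nc_one (nc_Delta K) (wv n m w) =
  \sum_(x <- word_fact w | (size x.2 != n) && (size x.2 != m)) wpair K n m x).
rewrite /cop_red_fun (negbTE ne) (nc_DeltaE K sw iw).
have el : vpure (nc_one n) (wv n m w) = wpair K n m (nseq n ncempty, w) by apply: wpairE.
have er : vpure (wv n m w) (nc_one m) = wpair K n m (w, nseq m ncempty).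
  by apply: wpairE; apply: size_nseq.
have cancel (V : zmodType) (x y z : V) : x + (y + z) - x - y = z.
  by rewrite [x + _]addrC addrK [y + _]addrC addrK.
by rewrite el er (sum_word_fact_red _ ne sw iw) cancel.
Qed.

Lemma cop_red_middle n m (c : H n m) : n != m ->
  in_middle (cop_red nc_one (nc_Delta K) n m c).
Proof.
move=> ne.
apply: (sp (P := fun c => in_middle (cop_red nc_one (nc_Delta K) n m c))) c => [|a x y mx my|_ [w sw iw]].
- by rewrite linear0; apply: in_middle0.
- by rewrite linearP; apply: in_middleP.
rewrite (cop_red_word ne sw iw).
exists [seq existT (fun k => (H n k * H k m)%type) (size x.2) (wv n (size x.2) x.1, wv (size x.2) m x.2)
  | x <- word_fact w & (size x.2 != n) && (size x.2 != m)]; split.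
  by rewrite all_map filter_all.
by rewrite big_map big_filter.
Qed.

(** Each application of the reduced coproduct lowers the number of inputs of the
   left factor, which stays at least its number of letters. *)
Lemma cop_red_iter0 r n m (c : H n m) : (m < n + r)%N ->
  cop_red_iter nc_one (nc_Delta K) r n m c = 0.
Proof.
elim: r n m c => [|r IH] n m c lt; first by rewrite addn0 in lt; apply: nc_words0.
change (vmap (cop_red_iter nc_one (nc_Delta K) r) (idhom H) n m
  (cop_red nc_one (nc_Delta K) n m c) = 0).
have [e|ne] := eqVneq n m.
  have -> : cop_red nc_one (nc_Delta K) n m c = 0.
    change (cop_red_fun nc_one (nc_Delta K) c = 0).
    by rewrite /cop_red_fun (introT eqP e).
  exact: linear0.
have [s [/allP ms ->]] := cop_red_middle c ne.
rewrite (linear_sum (vmap (cop_red_iter nc_one (nc_Delta K) r) (idhom H) n m)).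
apply: big1_seq => t /andP [_ /ms /andP [_ km]].
rewrite vmapE; case: (ltngtP (tag t) m) km => // lk _.
  by rewrite IH ?vpure0l // (leq_trans lk) // -ltnS -addnS.
by rewrite (nc_words0 (tagged t).2 lk) linear0 vpure0r.
Qed.

Lemma nc_conilpotent : is_conilpotent (nc_Delta K).
Proof.
exists nc_one; split.
- move=> n; split.
    rewrite /nc_one (wordvE K (size_nseq n ncempty) (inputs_nseq n)).
    apply/eqP => /(congr1 (mcoeff (mkword (size_nseq n ncempty) (inputs_nseq n)))).
    by rewrite mcoeffUU mcoeff0 => /eqP; rewrite oner_eq0.
  move=> x; apply: (sp (P := fun x => exists a, x = a *: nc_one n)) x.
  + by exists 0; rewrite scale0r.
  + by move=> a x y [b ->] [b' ->]; exists (a * b + b'); rewrite scalerDl scalerA.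
  + move=> _ [w sw iw]; exists 1; rewrite scale1r.
    by rewrite {1}(@inputs_size_eq w) ?sw ?iw.
- move=> m m0; split=> x; last exact: nc_words0.
  apply: (sp (P := fun c => c = 0)) x => // [a x y -> ->|_ [w sw iw]].
    by rewrite scaler0 addr0.
  by move: m0; rewrite -iw (size0nil sw).
- move=> n; apply: (etrans (nc_DeltaE K (size_nseq _ _) (inputs_nseq _))).
  rewrite word_fact_nseq big_seq1; apply/esym.
  exact: (wpairE K n n (nseq n ncempty) (size_nseq n ncempty)).
- by move=> n m c; apply: cop_red_middle.
- by move=> n m c _; exists m.+1; apply: cop_red_iter0; rewrite addnS ltnS leq_addl.
Qed.
End NCHopf.

Theorem proposition19 (R : realType) :
  is_hopf (A := nc_halg R[i]) (nc_Delta R[i]) (nc_nabla R[i]) (nc_S R[i])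
    (nc_eps R[i]) (nc_eta R[i]) /\
  is_conilpotent (nc_Delta R[i]).
Proof. by split; [apply: nc_hopf | apply: nc_conilpotent]. Qed.
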